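(* Let $p$ be a prime and $k\ge 0$ an integer. For a finite abelian $p$-group $\Gamma$ let $r_p(\Gamma)$ be its $p$-rank, so $p^{r_p(\Gamma)}=\#(\Gamma/p\Gamma)$. Then \[ \int_{(\Gamma,\delta)\in\mathcal{A}_p}p^{k\cdot r_p(\Gamma)}\,d\mu=\prod_{j=0}^{k-1}(p^j+1). \]
   Context: A duality pairing on a finite abelian group $\Gamma$ is a symmetric bilinear map $\delta:\Gamma\times\Gamma\to\mathbb{Q}/\mathbb{Z}$ such that $g\mapsto\delta(g,\cdot)$ is an isomorphism onto $\mathrm{Hom}(\Gamma,\mathbb{Q}/\mathbb{Z})$; $\mathrm{Aut}(\Gamma,\delta)$ is the group of pairing-preserving automorphisms. $\mathcal{A}_p$ is the set of isomorphism classes of pairs $(\Gamma,\delta)$ with $\Gamma$ a finite abelian $p$-group and $\delta$ a duality pairing on it. $\mu$ is the measure on $\mathcal{A}_p$ with $\mu(\Gamma,\delta)=\prod_{i=1}^\infty(1-p^{1-2i})/(\#\Gamma\cdot\#\mathrm{Aut}(\Gamma,\delta))$. *)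

(* Defs.v *)
From HB Require Import structures.
From mathcomp Require Import all_boot all_order all_fingroup all_algebra.
From mathcomp Require Import all_solvable.
From mathcomp Require Import all_classical all_reals all_analysis.
Set Implicit Arguments.
Unset Strict Implicit.
Unset Printing Implicit Defensive.
Import Order.TTheory GRing.Theory Num.Theory.
Import numFieldNormedType.Exports.
Local Open Scope quotient_scope.
Local Open Scope group_scope.
Local Open Scope ring_scope.

Definition QmodZ : zmodType :=
  Quotient.quot (GRing.ZmodClosed.clone rat Num.int_num_subdef _).

Section Pairing.
Variables (G : finZmodType) (delta : G -> G -> QmodZ).

(* The last two fields say that g |-> delta g is a bijection onto
   Hom(G, Q/Z); it is a group morphism by pairingDl, and its values are
   group morphisms by pairingDr. *)
Record duality_pairing : Prop := DualityPairing {
  pairing_sym : forall x y, delta x y = delta y x;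
  pairingDl : forall x y z, delta (x + y) z = delta x z + delta y z;
  pairingDr : forall x y z, delta x (y + z) = delta x y + delta x z;
  pairing_inj : forall x x', delta x =1 delta x' -> x = x';
  pairing_surj : forall f : {additive G -> QmodZ}, exists x, delta x =1 f
}.

Definition pairing_Aut : {set {perm G}} :=
  [set a in Aut [set: G]
    | [forall x, forall y, delta (a x) (a y) == delta x y]].

Lemma pairing_Aut_group_set : group_set pairing_Aut.
Proof.
apply/group_setP; split=> [|a b].
  by rewrite inE group1; apply/'forall_forallP=> x y; rewrite !perm1.
rewrite inE => /andP[Aa /'forall_forallP da].
rewrite inE => /andP[Ab /'forall_forallP db].
rewrite inE groupM//=; apply/'forall_forallP=> x y.
by rewrite !permM (eqP (db _ _)).
Qed.

Canonical pairing_Aut_group := Group pairing_Aut_group_set.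

End Pairing.

Definition pairing_iso (G H : finZmodType)
    (dG : G -> G -> QmodZ) (dH : H -> H -> QmodZ) : Prop :=
  exists f : {additive G -> H},
    bijective f /\ forall x y, dH (f x) (f y) = dG x y.

Section Rank.
Variables (p : nat) (G : finZmodType).

Definition pmultiples : {set G} := [set x *+ p | x in [set: G]].

Lemma pmultiples_group_set : group_set pmultiples.
Proof.
apply/group_setP; split=> [|_ _ /imsetP[x _ ->] /imsetP[y _ ->]].
  by apply/imsetP; exists 0; rewrite ?mul0rn ?inE.
by apply/imsetP; exists (x + y); rewrite ?inE // mulrnDl.
Qed.

Canonical pmultiples_group := Group pmultiples_group_set.

Definition prank : nat := logn p #|([set: G] / pmultiples)%g|.

Lemma pmultiples_normal : normal pmultiples [set: G].
Proof.
rewrite /normal finset.subsetT sub_abelian_norm ?finset.subsetT //.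
exact: FinRing.zmod_abelian.
Qed.

Lemma card_pquotient :
  #|([set: G] / pmultiples)%g| = (#|G| %/ #|pmultiples|)%N.
Proof.
rewrite card_quotient ?normal_norm ?pmultiples_normal//.
by rewrite -divgS ?finset.subsetT// cardsT.
Qed.

Lemma prankE : p.-group [set: G] ->
  (p ^ prank)%N = #|([set: G] / pmultiples)%g|.
Proof.
move=> pG; have : p.-group ([set: G] / pmultiples)%g by exact: quotient_pgroup.
by rewrite /prank => /card_pgroup <-.
Qed.

Lemma prank_p_rank : prime p -> p.-group [set: G] -> prank = 'r_p([set: G]).
Proof.
move=> pp pG; have aG : abelian [set: G] by exact: FinRing.zmod_abelian.
rewrite p_rank_abelian// /prank card_pquotient -cardsT.
rewrite -(mul_card_Ohm_Mho_abelian 1 aG).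
suff -> : pmultiples = 'Mho^1([set: G]) by rewrite mulnK// cardG_gt0.
by rewrite (MhoEabelian 1 pG aG) expn1.
Qed.

End Rank.

Section PairingIso.

Lemma pairing_iso_refl (G : finZmodType) (d : G -> G -> QmodZ) : pairing_iso d d.
Proof. by exists idfun; split=> //; exists id. Qed.

Lemma pairing_iso_sym (G H : finZmodType) (dG : G -> G -> QmodZ)
  (dH : H -> H -> QmodZ) : pairing_iso dG dH -> pairing_iso dH dG.
Proof.
move=> [f [[g fK gK] fd]].
have gM : zmod_morphism g by exact: can2_zmod_morphism fK gK.
pose g' : {additive H -> G} := HB.pack g (GRing.isZmodMorphism.Build H G g gM).
exists g'; split=> [|x y]; first by exists f.
by rewrite -fd /= !gK.
Qed.

Lemma pairing_iso_trans (G H K : finZmodType) (dG : G -> G -> QmodZ)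
  (dH : H -> H -> QmodZ) (dK : K -> K -> QmodZ) :
  pairing_iso dG dH -> pairing_iso dH dK -> pairing_iso dG dK.
Proof.
move=> [f [bf fd]] [g [bg gd]].
exists (g \o f : {additive G -> K}); split; first exact: bij_comp.
by move=> x y /=; rewrite gd fd.
Qed.

Lemma pairing_iso_prank p (G H : finZmodType) (dG : G -> G -> QmodZ)
  (dH : H -> H -> QmodZ) : pairing_iso dG dH -> prank p G = prank p H.
Proof.
move=> [f [bf _]]; rewrite /prank !card_pquotient (bij_eq_card bf).
congr (logn _ (_ %/ _)).
rewrite -(card_imset _ (bij_inj bf)); congr #|pred_of_set _|.
case: bf => g fK gK.
apply/setP => y; apply/imsetP/imsetP => [[_ /imsetP[x _ ->] ->]|[x _ ->]].
  by exists (f x); rewrite ?inE ?raddfMn.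
exists (g x *+ p); last by rewrite raddfMn gK.
by apply/imsetP; exists (g x).
Qed.

Lemma pairing_iso_card (G H : finZmodType) (dG : G -> G -> QmodZ)
  (dH : H -> H -> QmodZ) : pairing_iso dG dH -> #|G| = #|H|.
Proof. by move=> [f [bf _]]; exact: bij_eq_card bf. Qed.

Let leq_card_Aut (G H : finZmodType) (dG : G -> G -> QmodZ)
  (dH : H -> H -> QmodZ) : pairing_iso dG dH ->
  (#|pairing_Aut dG| <= #|pairing_Aut dH|)%N.
Proof.
move=> [f [[g fK gK] fd]].
have injc (a : {perm G}) : injective (f \o a \o g).
  by apply: inj_comp (can_inj gK); apply: inj_comp (can_inj fK) _; exact: perm_inj.
pose c (a : {perm G}) : {perm H} := perm (injc a).
have gM : {morph g : x y / x + y}.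
  by move=> x y; apply: (can_inj fK); rewrite raddfD !gK.
have cinj : injective c.
  move=> a b /permP ab; apply/permP => x; have := ab (f x).
  by rewrite !permE /= fK => /(can_inj fK).
rewrite -(card_imset _ cinj); apply/subset_leq_card/fintype.subsetP => _ /imsetP[a + ->].
rewrite !inE => /andP[/andP[_ /morphicP aM] /'forall_forallP ad].
apply/andP; split; first (apply/andP; split).
- by apply/fintype.subsetP => x _; rewrite inE.
- apply/morphicP => x y _ _; rewrite !permE /= -[(x * y)%g]/(x + y) gM.
  by rewrite -[g x + g y]/(g x * g y)%g aM ?inE// -[(_ * _)%g]/(_ + _) raddfD.
- apply/'forall_forallP => x y; rewrite !permE /= fd (eqP (ad _ _)).
  by rewrite -fd !gK.
Qed.

Lemma pairing_iso_card_Aut (G H : finZmodType) (dG : G -> G -> QmodZ)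
  (dH : H -> H -> QmodZ) : pairing_iso dG dH ->
  #|pairing_Aut dG| = #|pairing_Aut dH|.
Proof.
move=> i; apply/eqP; rewrite eqn_leq !leq_card_Aut//.
exact: pairing_iso_sym.
Qed.

End PairingIso.

(* Carriers are restricted to Set so that these groups form a type small
   enough to carry a measurable structure; dual_of_iso below shows that every
   pair is isomorphic to one of these. *)
Record dualPGroup (p : nat) := DualPGroup {
  dp_sort : Set;
  dp_class : FinRing.Zmodule dp_sort;
  dp_group :> finZmodType := FinRing.Zmodule.Pack dp_class;
  delta : dp_group -> dp_group -> QmodZ;
  dp_pgroup : p.-group [set: dp_group];
  dp_duality : duality_pairing delta
}.
Arguments delta {p} d x y.

HB.instance Definition _ p := gen_eqMixin (dualPGroup p).
HB.instance Definition _ p := gen_choiceMixin (dualPGroup p).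

(* 'I_n is not in Set. *)
Definition small (G : finZmodType) : Set := {i : nat | (i < #|G|)%N}.

Section Small.
Variable G : finZmodType.

Let s (x : G) : small G := exist _ (val (enum_rank x)) (ltn_ord _).
Let v (x : small G) : G := enum_val (Ordinal (proj2_sig x)).
Let sK : cancel s v.
Proof. by move=> x; rewrite -[RHS]enum_rankK; congr enum_val; exact: val_inj. Qed.
Let vK : cancel v s.
Proof. by move=> [i Hi]; apply: eq_exist; rewrite /= enum_valK. Qed.

HB.instance Definition _ := Finite.copy (small G) (can_type vK).

Let add (x y : small G) : small G := s (v x + v y).
Let opp (x : small G) : small G := s (- v x).
Let addA : associative add.
Proof. by move=> x y z; rewrite /add !sK addrA. Qed.
Let addC : commutative add.
Proof. by move=> x y; rewrite /add addrC. Qed.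
Let add0 : left_id (s 0) add.
Proof. by move=> x; rewrite /add sK add0r vK. Qed.
Let addN : left_inverse (s 0) opp add.
Proof. by move=> x; rewrite /add sK addNr. Qed.
HB.instance Definition _ := GRing.isZmodule.Build (small G) addA addC add0 addN.

Lemma small_iso : exists f : {additive G -> small G}, bijective f.
Proof.
have sM : zmod_morphism s.
  by move=> x y; apply: (can_inj vK); rewrite sK [RHS]sK sK [X in _ = _ + X]sK sK.
pose s' : {additive G -> small G} :=
  HB.pack s (GRing.isZmodMorphism.Build G (small G) s sM).
exists s'.
by exists v.
Qed.
End Small.

Lemma duality_pairing_iso (G H : finZmodType) (dG : G -> G -> QmodZ)
  (dH : H -> H -> QmodZ) :
  pairing_iso dG dH -> duality_pairing dG -> duality_pairing dH.
Proof.
move=> [f [[g fK gK] fd]] [dsym dl dr dinj dsurj].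
have gM : {morph g : x y / x + y}.
  by move=> x y; apply: (can_inj fK); rewrite raddfD !gK.
have dHE x y : dH x y = dG (g x) (g y) by rewrite -fd !gK.
split=> [x y|x y z|x y z|x x' xx'|h]; rewrite ?dHE ?gM//.
- by apply: (can_inj gK); apply: dinj => y; rewrite -(fK y) -!dHE.
- have [x xh] := dsurj (h \o f : {additive G -> QmodZ}).
  by exists (f x) => y; rewrite dHE fK xh /= gK.
Qed.

Lemma dual_of_iso (p : nat) (G : finZmodType) (d : G -> G -> QmodZ) :
  p.-group [set: G] -> duality_pairing d ->
  exists A : dualPGroup p, pairing_iso d (delta A).
Proof.
move=> pG dd; have [f bf] := small_iso G.
have [g fK gK] := bf.
pose d' (x y : small G) := d (g x) (g y).
have i : pairing_iso d d' by exists f; split=> // x y; rewrite /d' !fK.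
pose S : finZmodType := small G.
have pS : p.-group [set: S].
  by move: pG; rewrite /pgroup !cardsT (bij_eq_card bf).
by exists (@DualPGroup p (small G) (FinRing.Zmodule.on (small G)) d' pS
  (duality_pairing_iso i dd)).
Qed.

Section IsoClass.
Variable p : nat.
Implicit Types A B : dualPGroup p.

Definition dual_iso A B : bool := `[< pairing_iso (delta A) (delta B) >].

Lemma dual_iso_is_equiv : equiv_class_of dual_iso.
Proof.
split=> [A|A B|B A C].
- exact/asboolP/pairing_iso_refl.
- by apply/asboolP/asboolP; exact: pairing_iso_sym.
- by move=> /asboolP i /asboolP j; apply/asboolP; exact: pairing_iso_trans i j.
Qed.

Canonical dual_iso_equiv := EquivRelPack dual_iso_is_equiv.
Canonical dual_iso_encModRel := defaultEncModRel dual_iso.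

Definition isoClass := {eq_quot dual_iso}.
HB.instance Definition _ : EqQuotient _ dual_iso isoClass :=
  EqQuotient.on isoClass.
HB.instance Definition _ := Choice.on isoClass.

Lemma isoClass_eqP A B :
  \pi_isoClass A = \pi_isoClass B <-> pairing_iso (delta A) (delta B).
Proof. by split=> [/eqmodP/asboolP|i]//; apply/eqmodP/asboolP. Qed.

Lemma isoClass_inhabited : exists A : dualPGroup p, True.
Proof.
pose G : finZmodType := 'I_1.
have pG : p.-group [set: G] by rewrite /pgroup cardsT card_ord.
have dd : duality_pairing (fun _ _ : G => 0 : QmodZ).
  split=> //=; rewrite ?addr0//; first by move=> x y _; rewrite !ord1.
  by move=> f; exists 0 => x; rewrite ord1 raddf0.
by have [A _] := dual_of_iso pG dd; exists A.
Qed.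

HB.instance Definition _ := isPointed.Build isoClass
  (\pi_isoClass (projT1 (cid isoClass_inhabited))).

HB.instance Definition _ := @isMeasurable.Build default_measure_display
  isoClass discrete_measurable discrete_measurable0
  discrete_measurableC discrete_measurableU.

End IsoClass.

Section Mu.
Local Open Scope classical_set_scope.
Variables (R : realType) (p : nat).

Definition mu_factor (i : nat) : R := 1 - p%:R ^ (1 - (2 * i)%:Z).

Definition mu_partial (n : nat) : R := \prod_(1 <= i < n.+1) mu_factor i.

Definition mu_product : R := limn mu_partial.

Lemma mu_factor_bound i : (0 < i)%N -> 0 <= mu_factor i <= 1.
Proof.
case: i => // i _; rewrite /mu_factor.
have -> : 1 - (2 * i.+1)%:Z = - (2 * i).+1%:Z :> int.
  by rewrite mulnS -opprB; congr (- _); rewrite subzn.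
rewrite -exprz_inv -exprnP; set q : R := p%:R^-1.
have q0 : 0 <= q by rewrite invr_ge0.
have q1 : q <= 1.
  rewrite /q; case: p => [|n]; first by rewrite invr0.
  by rewrite invf_le1 ?ltr0n// ler1n.
by rewrite subr_ge0 exprn_ile1//= gerBl exprn_ge0.
Qed.

Lemma mu_partial_ge0 n : 0 <= mu_partial n.
Proof.
rewrite /mu_partial big_nat_cond; apply: prodr_ge0 => i.
by rewrite andbT => /andP[i0 _]; have /andP[] := mu_factor_bound i0.
Qed.

Lemma is_cvg_mu_partial : cvgn mu_partial.
Proof.
apply: nonincreasing_is_cvgn; last first.
  by exists 0 => _ [n _ <-]; exact: mu_partial_ge0.
apply/nonincreasing_seqP => n; rewrite /mu_partial big_nat_recr//=.
have /andP[_ h] := mu_factor_bound (ltn0Sn n).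
by apply: ler_piMr; [exact: mu_partial_ge0|].
Qed.

Lemma mu_product_ge0 : 0 <= mu_product.
Proof.
apply: limr_ge; first exact: is_cvg_mu_partial.
by apply: nearW => n; exact: mu_partial_ge0.
Qed.

Definition mass (A : dualPGroup p) : R :=
  mu_product / (#|A| * #|pairing_Aut (delta A)|)%:R.

Lemma mass_ge0 A : 0 <= mass A.
Proof. by rewrite divr_ge0 ?mu_product_ge0. Qed.

Lemma mass_iso A B : pairing_iso (delta A) (delta B) -> mass A = mass B.
Proof.
by move=> i; rewrite /mass (pairing_iso_card i) (pairing_iso_card_Aut i).
Qed.

(* The choice of representative is immaterial: class_mass_pi, class_prank_pi. *)
Definition class_mass (x : isoClass p) : R := mass (generic_quotient.repr x).
Definition class_prank (x : isoClass p) : nat := prank p (generic_quotient.repr x).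

Let repr_iso A : pairing_iso (delta A) (delta (generic_quotient.repr (\pi_(isoClass p) A))).
Proof. by apply/isoClass_eqP; rewrite reprK. Qed.

Lemma class_mass_pi A : class_mass (\pi_(isoClass p) A) = mass A.
Proof. exact/esym/mass_iso/repr_iso. Qed.

Lemma class_prank_pi A : class_prank (\pi_(isoClass p) A) = prank p A.
Proof. exact/esym/pairing_iso_prank/repr_iso. Qed.

Definition mu (X : set (isoClass p)) : \bar R :=
  \esum_(x in X) (class_mass x)%:E.

Let mu0 : mu set0 = 0%E. Proof. exact: esum_set0. Qed.

Let mu_ge0 X : (0 <= mu X)%E.
Proof. by apply: esum_ge0 => x _; rewrite lee_fin mass_ge0. Qed.

Let mu_sigma_additive : semi_sigma_additive mu.
Proof.
move=> F _ tF _; rewrite [X in _ --> X](_ : _ = \sum_(i <oo) mu (F i))%E.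
  by apply: is_cvg_ereal_nneg_natsum => i _; exact: mu_ge0.
rewrite nneseries_esumT//= [LHS]esum_bigcupT// => x.
by rewrite lee_fin mass_ge0.
Qed.

HB.instance Definition _ := isMeasure.Build _ _ _ mu
  mu0 mu_ge0 mu_sigma_additive.

Lemma mu1 x : mu [set x] = (class_mass x)%:E.
Proof. by rewrite /mu esum_set1// lee_fin mass_ge0. Qed.

End Mu.

(* Main.v *)
From HB Require Import structures.
Require Import Defs.
From mathcomp Require Import all_boot all_order all_fingroup all_algebra.
From mathcomp Require Import all_solvable lra zify.
From mathcomp Require Import all_classical all_reals all_analysis.
Set Implicit Arguments.
Unset Strict Implicit.
Unset Printing Implicit Defensive.
Import Order.TTheory GRing.Theory Num.Theory.
Import numFieldNormedType.Exports.
Local Open Scope ring_scope.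

(** Fix [R = Z/p^(M+1)].  Sending a generating [n]-tuple of a pair [(A, delta)]
    killed by [p^(M+1)] to its Gram matrix identifies the symmetric [n x n]
    matrices over [R] with pairs equipped with a generating tuple, so a class
    accounts for [#Sur(R^n, A) / #Aut(A, delta)] matrices.  Let [W_r(m)] be the
    total of [1 / (#A #Aut(A, delta))] over the pairs of rank [r] killed by
    [p^m].  If [A] has rank exactly [n] and Gram matrix [S], then [p A] has Gram
    matrix [p S], and [S] can be recovered from [p S] up to a symmetric form on
    [F_p^n] which must be nondegenerate on the radical of [p S] modulo [p].
    Counting these lifts, and all symmetric matrices over [F_p], gives
      [p^(r(r+1)/2) W_r(m+1) = sum_(s <= r) v_(r-s) W_s(m)] and
      [p^(r(r+1)/2) / D_r = sum_(s <= r) v_(r-s) / D_s],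
    with the same [v_t] and [D_r = prod_(1 <= i <= r) (p^i - 1)].  Hence [W_r(m)]
    tends to [1 / D_r], i.e. rank [r] has measure [prod_i (1 - p^(1-2i)) / D_r].
    The moments follow since [F(y) = sum_r y^r / D_r] satisfies
    [F(p y) = (1 + y) F(y)], which also gives [F(1) = prod_i (1 + p^(-i))] and so
    Euler's identity [F(1) prod_i (1 - p^(1-2i)) = 1]. *)

(** * Fibre counting, and matrices of full rank over a finite field *)

Section Counting.

Lemma card_fibers (aT rT : finType) (f : aT -> rT) (D : {set aT}) (k : nat) :
  (forall x, x \in D -> #|[set y in D | f y == f x]%SET| = k) ->
  #|D| = (#|[set f x | x in D]%SET| * k)%N.
Proof.
move=> fk; rewrite -sum1_card (partition_big_imset f) /= -sum_nat_const.
apply: eq_bigr => _ /imsetP[x Dx ->].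
by rewrite sum1dep_card -(fk x Dx) cardsE.
Qed.

(** The fibres of [f] on the subgroup [D] are the cosets of its kernel in [D]. *)
Lemma card_additive_image (U V : finZmodType) (f : {additive U -> V})
    (D : {set U}) :
  0 \in D -> {in D &, forall x y, x - y \in D} ->
  #|D| = (#|[set f x | x in D]%SET| * #|[set x in D | f x == 0%R]%SET|)%N.
Proof.
move=> D0 DB; apply: card_fibers => x Dx.
rewrite -(card_imset [pred y in [set x in D | f x == 0]%SET] (addrI x)).
apply: eq_card => y; rewrite !inE; apply/andP/imsetP => [[Dy /eqP fyx]|].
  exists (y - x); last by rewrite addrCA subrr addr0.
  by rewrite !inE DB// raddfB fyx subrr eqxx.
case=> z; rewrite !inE => /andP[Dz /eqP fz] ->.
rewrite raddfD fz addr0 eqxx; split=> //.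
have -> : x + z = x - (0 - z) by rewrite sub0r opprK.
by rewrite !DB.
Qed.

(** Rows are added one at a time: a new row keeps the matrix free exactly when it avoids the row
    space of the [m] rows already there, which has [#|F| ^ m] elements. *)
Lemma card_row_free (F : finFieldType) m n :
  #|[set A : 'M[F]_(m, n) | row_free A]%SET| = (\prod_(i < m) (#|F| ^ n - #|F| ^ i))%N.
Proof.
elim: m => [|m IHm].
  rewrite big_ord0 (_ : [set A | _]%SET = [set 0]%SET) ?cards1//.
  by apply/setP => A; rewrite !inE flatmx0 eqxx; apply: inj_row_free => v; rewrite thinmx0.
pose f (x : 'rV[F]_n * 'M[F]_(m, n)) : 'M[F]_(1 + m, n) := col_mx x.1 x.2.
have f_inj : injective f by move=> [u A] [u' A'] /eq_col_mx[/= -> ->].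
have fP (u : 'rV[F]_n) (A : 'M[F]_(m, n)) :
    row_free (col_mx u A) = row_free A && ~~ (u <= A)%MS.
  apply/idP/andP => [fr|[fA uA]].
    split.
      apply: inj_row_free => w wA.
      have : row_mx 0 w *m col_mx u A = 0 *m col_mx u A.
        by rewrite mul_row_col mul0mx add0r wA mul0mx.
      by move=> /(row_free_inj fr)/eqP; rewrite -row_mx0 => /eqP/eq_row_mx[].
    apply/negP => /submxP[w uE].
    have : row_mx 1%:M (- w) *m col_mx u A = 0 *m col_mx u A.
      by rewrite mul_row_col mul1mx mulNmx -uE subrr mul0mx.
    move=> /(row_free_inj fr)/eqP; rewrite -row_mx0 => /eqP/eq_row_mx[/matrixP/(_ 0 0)].
    by rewrite !mxE eqxx => /eqP; rewrite oner_eq0.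
  apply: inj_row_free => v; rewrite -[v]hsubmxK mul_row_col => vA.
  have v0 : lsubmx v = 0.
    apply/eqP; apply: contraNT uA => v0; apply/submxP.
    have {}v0 : lsubmx v 0 0 != 0.
      by apply: contra v0 => /eqP v0; apply/eqP/matrixP => i j; rewrite !ord1 v0 mxE.
    exists (- (lsubmx v 0 0)^-1 *: rsubmx v).
    rewrite -scalemxAl; apply: (scalerI v0); rewrite scalerA mulrN divff// scaleN1r.
    apply/eqP; rewrite -addr_eq0 -mul_scalar_mx -mx11_scalar.
    exact/eqP.
  move: vA; rewrite v0 mul0mx add0r -[X in _ = X](mul0mx _ A) => /(row_free_inj fA) ->.
  by rewrite row_mx0.
have -> : #|[set A : 'M[F]_(1 + m, n) | row_free A]%SET| =
    #|[set x : 'rV[F]_n * 'M[F]_(m, n) | row_free x.2 && ~~ (x.1 <= x.2)%MS]%SET|.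
  rewrite -(card_imset (mem [set x | _]%SET) f_inj); apply: eq_card => A; rewrite inE.
  apply/idP/imsetP => [|[[u A']]]; last by rewrite inE -fP => fr ->.
  rewrite -[A]vsubmxK fP => fr; exists (usubmx A, dsubmx A) => //.
  by rewrite inE.
rewrite big_ord_recr /= -IHm -[LHS]sum1_card.
rewrite (eq_bigl (fun x : 'rV[F]_n * 'M[F]_(m, n) =>
  row_free x.2 && ~~ (x.1 <= x.2)%MS)); last by move=> x; rewrite inE.
rewrite (reindex_onto (fun x : 'M[F]_(m, n) * 'rV[F]_n => (x.2, x.1))
  (fun x => (x.2, x.1))) /=; last by case.
rewrite (eq_bigl (fun x : 'M[F]_(m, n) * 'rV[F]_n =>
  row_free x.1 && ~~ (x.2 <= x.1)%MS)); last first.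
  by move=> [A u] /=; rewrite eqxx andbT.
rewrite -(pair_big_dep (fun A : 'M[F]_(m, n) => row_free A)
  (fun A (u : 'rV[F]_n) => ~~ (u <= A)%MS) (fun _ _ => 1%N)) /=.
rewrite -sum_nat_const (eq_bigl (fun A => A \in [set A | row_free A]%SET)); last first.
  by move=> A; rewrite inE.
apply: eq_bigr => A; rewrite inE => fA; rewrite sum1_card.
have inj : injective (fun u : 'rV[F]_m => u *m A) by exact: row_free_inj.
have -> : (#|F| ^ m)%N = #|{: 'rV[F]_m}| by rewrite card_mx mul1n.
have -> : (#|F| ^ n)%N = #|{: 'rV[F]_n}| by rewrite card_mx mul1n.
rewrite -(card_imset _ inj) -(cardC [set u *m A | u : 'rV[F]_m]%SET) addKn.
apply: eq_card => u; rewrite !inE; congr (~~ _).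
by apply/submxP/imsetP => [[w ->]|[w _ ->]]; exists w.
Qed.

End Counting.

(** * Symmetric forms over Z/p^(M+1) *)

Section Zpk.
Variables (p M : nat).
Hypothesis p_prime : prime p.

Notation N := (p ^ M.+1)%N.
Notation R := 'Z_(p ^ M.+1).

Let N_gt1 : (1 < N)%N.
Proof. by rewrite -(exp1n M.+1) ltn_exp2r// prime_gt1. Qed.

Let dvdN_mulpM (n : nat) : (N %| n * p ^ M)%N = (p %| n)%N.
Proof. by rewrite expnS dvdn_pmul2r// expn_gt0 prime_gt0. Qed.

Let dvdN_mulp (n : nat) : (N %| n * p)%N = (p ^ M %| n)%N.
Proof. by rewrite expnSr dvdn_pmul2r// prime_gt0. Qed.

Let N_Fp : N%:R = 0 :> 'F_p.
Proof. by rewrite expnS natrM pchar_Fp_0// mul0r. Qed.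

Lemma card_Zpk : #|R| = N.
Proof. by rewrite card_ord Zp_cast. Qed.

Lemma Zpk_nat_eq0 (n : nat) : (n%:R == 0 :> R) = (N %| n)%N.
Proof. by rewrite -val_eqE /= val_Zp_nat. Qed.

Lemma Zpk_natE (a : R) : a = (a : nat)%:R.
Proof. by rewrite natr_Zp. Qed.

Lemma Zpk_torsion m n (A : 'M[R]_(m, n)) : A *+ N = 0.
Proof. by apply/matrixP => i j; rewrite mulmxnE mxE -mulr_natr pchar_Zp ?mulr0. Qed.

(** A set-theoretic section of multiplication by [p], meaningful on the multiples of [p], that is,
    on the elements killed by [p ^ M]. *)
Definition pquo (a : R) : R := ((a : nat) %/ p)%:R.

Lemma pquoK (a : R) : a *+ p ^ M = 0 -> pquo a *+ p = a.
Proof.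
rewrite {1}(Zpk_natE a) -mulrnA => /eqP; rewrite Zpk_nat_eq0 dvdN_mulpM => pa.
by rewrite /pquo -mulrnA divnK// -Zpk_natE.
Qed.

Lemma pquo_mxK m n (A : 'M[R]_(m, n)) :
  A *+ p ^ M = 0 -> map_mx pquo A *+ p = A.
Proof.
move=> /matrixP A0; apply/matrixP => i j; rewrite mulmxnE mxE pquoK//.
by have := A0 i j; rewrite mulmxnE mxE.
Qed.

Definition red (a : R) : 'F_p := (a : nat)%:R.

Let red_nat (n : nat) : red n%:R = n%:R.
Proof.
rewrite /red val_Zp_nat// {2}(divn_eq n N) natrD natrM N_Fp.
by rewrite mulr0 add0r.
Qed.

Let red_zmod : zmod_morphism red.
Proof.
move=> a b; have bN : (b <= N)%N by rewrite ltnW// -[ltnRHS](Zp_cast N_gt1) ltn_ord.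
have -> : a - b = (a + (N - b))%:R.
  by rewrite natrD natrB// pchar_Zp// sub0r -!Zpk_natE.
by rewrite red_nat natrD natrB// N_Fp sub0r.
Qed.

Let red_monoid : monoid_morphism red.
Proof.
split=> [|a b]; first by rewrite -[1]/(1%:R) red_nat.
by rewrite {1}(Zpk_natE a) {1}(Zpk_natE b) -natrM red_nat natrM.
Qed.

HB.instance Definition _ := GRing.isZmodMorphism.Build R 'F_p red red_zmod.
HB.instance Definition _ := GRing.isMonoidMorphism.Build R 'F_p red red_monoid.

Definition lift_Fp (x : 'F_p) : R := (x : nat)%:R.

Lemma lift_FpK : cancel lift_Fp red.
Proof. by move=> x; rewrite /lift_Fp red_nat natr_Zp. Qed.

Lemma red_eq0 (a : R) : (red a == 0) = (a *+ p ^ M == 0).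
Proof.
rewrite {2}(Zpk_natE a) -mulrnA Zpk_nat_eq0 dvdN_mulpM.
by rewrite -val_eqE /= val_Fp_nat.
Qed.

Lemma red_mx_eq0 m n (A : 'M[R]_(m, n)) :
  (map_mx red A == 0) = (A *+ p ^ M == 0).
Proof.
apply/eqP/eqP => /matrixP A0; apply/matrixP => i j; have /eqP := A0 i j.
  by rewrite !mxE mulmxnE red_eq0 => /eqP.
by rewrite mulmxnE !mxE -red_eq0 => /eqP.
Qed.

Lemma lift_mxK m n (A : 'M['F_p]_(m, n)) : map_mx red (map_mx lift_Fp A) = A.
Proof. by apply/matrixP => i j; rewrite !mxE lift_FpK. Qed.

Lemma red_unit (a : R) : red a != 0 -> a \is a GRing.unit.
Proof.
rewrite red_eq0 {1}(Zpk_natE a) -mulrnA Zpk_nat_eq0 dvdN_mulpM => pa.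
by rewrite (Zpk_natE a) unitZpE// coprimeXl// prime_coprime.
Qed.

Lemma red_unitmx n (A : 'M[R]_n) : map_mx red A \in unitmx -> A \in unitmx.
Proof. by rewrite !unitmxE det_map_mx unitfE => /red_unit. Qed.

(** The [p]-torsion of [R] is [p ^ M R], and multiplication by [p ^ M] factors through reduction
    modulo [p]. Matrices over [F_p] can thus be handled as matrices over [R] killed by [p]. *)
Lemma Zpk_torsion_p m n (A : 'M[R]_(m, n)) : A *+ p = 0 ->
  exists B : 'M['F_p]_(m, n), A = map_mx lift_Fp B *+ p ^ M.
Proof.
move=> /matrixP A0.
pose C : 'M[R]_(m, n) := \matrix_(i, j) ((A i j : nat) %/ p ^ M)%:R.
have -> : A = C *+ p ^ M.
  apply/matrixP => i j; rewrite mulmxnE mxE -mulrnA divnK -?Zpk_natE//.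
  have /eqP := A0 i j; rewrite mulmxnE mxE {1}(Zpk_natE (A i j)) -mulrnA.
  by rewrite Zpk_nat_eq0 dvdN_mulp.
exists (map_mx red C); apply/eqP; rewrite -subr_eq0 -mulrnBl -red_mx_eq0.
by rewrite map_mxB lift_mxK subrr.
Qed.

Lemma card_torsion_p m n :
  #|[set A : 'M[R]_(m, n) | A *+ p == 0]%SET| = (p ^ (m * n))%N.
Proof.
pose f (B : 'M['F_p]_(m, n)) := map_mx lift_Fp B *+ p ^ M.
have f_inj : injective f.
  move=> B C /eqP; rewrite -subr_eq0 -mulrnBl -red_mx_eq0 map_mxB !lift_mxK.
  by rewrite subr_eq0 => /eqP.
rewrite -[in RHS](card_Fp p_prime) -card_mx -(card_imset _ f_inj).
apply: eq_card => A; rewrite inE; apply/eqP/imsetP => [A0|[B _ ->]].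
  by have [B ->] := Zpk_torsion_p A0; exists B.
by rewrite -mulrnA -expnSr Zpk_torsion.
Qed.

(** The ideal of [d] is generated by [g], the gcd of [N] and [d]. Since [N / g] kills [d], it kills
    [c], which forces [g] to divide [c]; Bezout then writes [g] as a multiple of [d]. *)
Let annihilator_ideal (c d : R) :
  (forall a : R, a * d = 0 -> a * c = 0) -> exists w, c = d * w.
Proof.
move=> dc; have N_gt0 := ltnW N_gt1; set g := gcdn N d.
have gN : (g %| N)%N := dvdn_gcdl _ _.
have g_gt0 : (0 < g)%N by rewrite gcdn_gt0 N_gt0.
have gc : (g %| c)%N.
  have /dc : (N %/ g)%:R * d = 0.
    apply/eqP; rewrite {1}(Zpk_natE d) -natrM Zpk_nat_eq0 mulnC.
    by rewrite /g gcdnC muln_divCA_gcd dvdn_mulr.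
  rewrite {1}(Zpk_natE c) -natrM => /eqP; rewrite Zpk_nat_eq0.
  by rewrite -{1}(divnK gN) dvdn_pmul2l// divn_gt0// dvdn_leq.
have [u _ /dvdnP[v uv]] := Bezoutl (d : nat) N_gt0.
have ug : g%:R = d * - (u%:R : R).
  have /eqP : ((g + u * d)%:R : R) == 0.
    by rewrite Zpk_nat_eq0 /g uv; exact: dvdn_mull.
  by rewrite natrD natrM -Zpk_natE mulrC => /eqP; rewrite addr_eq0 mulrN => /eqP.
exists (- u%:R * ((c : nat) %/ g)%:R).
by rewrite mulrA -ug -natrM mulnC divnK// -Zpk_natE.
Qed.

(* The double annihilator property of Z/N: by Smith normal form it reduces to
   the one-dimensional case. *)
Lemma annihilator_column m n (S : 'M[R]_(m, n)) (c : 'cV[R]_m) :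
  (forall v : 'rV[R]_m, v *m S = 0 -> v *m c = 0) ->
  exists w : 'cV[R]_n, c = S *m w.
Proof.
move=> Sc.
pose SZ : 'M[int]_(m, n) := \matrix_(i, j) (S i j : nat)%:Z.
have [L uL [Q uQ [d _ SZE]]] := int_Smith_normal_form SZ.
pose f : {rmorphism int -> R} := intmul 1.
set Dg := (X in _ *m X *m _) in SZE.
have SE : S = map_mx f L *m map_mx f Dg *m map_mx f Q.
  rewrite -!map_mxM -SZE; apply/matrixP => i j; rewrite !mxE.
  exact: Zpk_natE.
have uLf : map_mx f L \in unitmx by rewrite unitmxE det_map_mx rmorph_unit.
have uQf : map_mx f Q \in unitmx by rewrite unitmxE det_map_mx rmorph_unit.
pose c' := invmx (map_mx f L) *m c.
have [w' cw] : exists w', c' = map_mx f Dg *m w'.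
  have c'0 (a : R) (i : 'I_m) : a *: ((delta_mx 0 i : 'rV[R]_m) *m map_mx f Dg) = 0 ->
      a * c' i 0 = 0.
    move=> aD; have := Sc (a *: delta_mx 0 i *m invmx (map_mx f L)).
    rewrite SE !mulmxA mulmxKV// -(scalemxAl a _ (map_mx f Dg)) aD.
    rewrite mul0mx => /(_ erefl); rewrite -mulmxA -/c' -scalemxAl.
    move/matrixP/(_ 0 0).
    by rewrite !mxE (bigD1 i)//= big1 ?addr0 ?mxE ?eqxx ?mul1r// => j ji;
       rewrite !mxE (negPf ji) mul0r.
  have rowD i j : ((delta_mx 0 i : 'rV[R]_m) *m map_mx f Dg) 0 j =
      f d`_i *+ ((i : nat) == j).
    rewrite !mxE (bigD1 i)//= big1 ?addr0.
      by rewrite !mxE !eqxx mul1r rmorphMn.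
    by move=> k ki; rewrite !mxE (negPf ki) mul0r.
  (* A row of index at least [n] of the diagonal matrix is zero; the factor [(i < n)] makes its
     diagonal entry zero. *)
  have ex i : exists w : R, c' i 0 == f d`_i *+ (i < n)%N * w.
    suff [w ->] : exists w : R, c' i 0 = f d`_i *+ (i < n)%N * w by exists w.
    apply: annihilator_ideal => a ad; apply: c'0.
    apply/rowP => j; rewrite mxE rowD [RHS]mxE.
    case: eqP => [ij|_]; last by rewrite mulr0n mulr0.
    by move: ad; rewrite ij ltn_ord.
  pose w i := xchoose (ex i).
  (* Each sum has at most one term. It only carries an index below [m] to the same index below [n],
     with value 0 when there is none. *)
  exists (\col_(j < n) \sum_(i < m | (i : nat) == j) w i).
  apply/colP => i; rewrite (eqP (xchooseP (ex i))) -/(w i) !mxE.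
  have [i_n|n_i] := ltnP i n; last first.
    rewrite mulr0n mul0r big1// => j _; rewrite !mxE.
    case: eqP => [ij|_]; last by rewrite mulr0n rmorph0 mul0r.
    by have := ltn_ord j; rewrite -ij ltnNge n_i.
  rewrite (bigD1 (Ordinal i_n))//= big1 ?addr0 => [|j ji].
    rewrite !mxE eqxx !mulr1n; congr (_ * _).
    rewrite (big_pred1 i)// => k.
  rewrite !mxE; case: eqP => [ij|_]; last by rewrite mulr0n rmorph0 mul0r.
  by case/eqP: ji; apply: val_inj.
exists (invmx (map_mx f Q) *m w').
by rewrite SE -!mulmxA mulKVmx// -cw mulKVmx.
Qed.

Let p_gt0 : (0 < p)%N := prime_gt0 p_prime.

(** * Radical, size and rank of a form *)

Definition radical n (S : 'M[R]_n) : {set 'rV[R]_n} :=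
  [set v | v *m S == 0]%SET.

(** The order of the group presented by [S]: a pair with Gram matrix [S] on a generating tuple is
    isomorphic to the row space of [S]. *)
Definition form_size n (S : 'M[R]_n) : nat :=
  #|[set v *m S | v : 'rV[R]_n]%SET|.

(** The [p]-rank of the group presented by [S], as the logarithm of the index of its subgroup of
    multiples of [p]. *)
Definition form_rank n (S : 'M[R]_n) : nat :=
  logn p (form_size S %/ form_size (S *+ p)).

(* [v *+ p ^ M == 0] says that [v] is divisible by [p]. *)
Definition full_form n (S : 'M[R]_n) : bool :=
  [forall v : 'rV[R]_n, (v *m S == 0) ==> (v *+ p ^ M == 0)].

Lemma full_formP n (S : 'M[R]_n) :
  reflect (forall v : 'rV[R]_n, v *m S = 0 -> v *+ p ^ M = 0) (full_form S).
Proof.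
apply: (iffP forallP) => [h v /eqP vS|h v]; first by have := h v; rewrite vS => /eqP.
by apply/implyP => /eqP/h ->.
Qed.

Lemma mulmxMnr m n k (A : 'M[R]_(m, n)) (B : 'M[R]_(n, k)) i :
  A *m (B *+ i) = (A *m B) *+ i.
Proof. exact: (raddfMn (mulmx A)). Qed.

Lemma mulmxMnl m n k (A : 'M[R]_(m, n)) (B : 'M[R]_(n, k)) i :
  (A *+ i) *m B = (A *m B) *+ i.
Proof. exact: (raddfMn (mulmxr B)). Qed.

Lemma mulrn_pquo m n (v : 'M[R]_(m, n)) :
  v *+ p ^ M = 0 -> exists z, v = z *+ p.
Proof. by move=> v0; exists (map_mx pquo v); rewrite pquo_mxK. Qed.

Lemma mulrn_p_torsion m n (v : 'M[R]_(m, n)) : v *+ p *+ p ^ M = 0.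
Proof. by rewrite -mulrnA -expnS Zpk_torsion. Qed.

Lemma form_size_radical n (S : 'M[R]_n) :
  (form_size S * #|radical S|)%N = (N ^ n)%N.
Proof.
have := @card_additive_image _ _ (mulmxr S) [set: 'rV[R]_n]%SET (finset.in_setT _)
  (fun x y _ _ => finset.in_setT _).
rewrite cardsT card_mx card_Zpk// mul1n => ->; congr (_ * _)%N.
  by apply: eq_card => x; apply/imsetP/imsetP => -[v _ ->]; exists v.
by apply: eq_card => x; rewrite !inE.
Qed.

Lemma form_size_gt0 n (S : 'M[R]_n) : (0 < form_size S)%N.
Proof.
have : (0 < N ^ n)%N by rewrite !expn_gt0 p_gt0.
by rewrite -(form_size_radical S) muln_gt0 => /andP[].
Qed.

Lemma radicalB n (S : 'M[R]_n) : {in radical S &, forall x y, x - y \in radical S}.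
Proof. by move=> x y; rewrite !inE mulmxBl => /eqP -> /eqP ->; rewrite subrr. Qed.

(** Multiplication by [p] maps the radical of [p S] onto the multiples of [p] in the radical of [S].
    Its kernel is the whole [p]-torsion of [R^n], of order [p ^ n]. *)
Lemma card_radical_mulp n (S : 'M[R]_n) :
  #|radical (S *+ p)| =
    (#|[set v in radical S | (v *+ p ^ M == 0)%R]%SET| * p ^ n)%N.
Proof.
rewrite (@card_additive_image _ _ ( *:%R (p%:R : R) : {additive 'rV[R]_n -> 'rV[R]_n})
  (radical (S *+ p))) ?inE ?mul0mx//; last exact: radicalB.
congr (_ * _)%N.
  apply: eq_card => v; rewrite !inE; apply/imsetP/andP => [[w]|[/eqP vS /eqP v0]].
    rewrite inE => /eqP wS -> /=; rewrite scaler_nat mulrn_p_torsion eqxx; split=> //.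
    by rewrite mulmxMnl -mulmxMnr wS.
  have [z zE] := mulrn_pquo v0; exists z; last by rewrite /= scaler_nat.
  by rewrite inE mulmxMnr -mulmxMnl -zE vS.
rewrite -[n in RHS]mul1n -(card_torsion_p 1 n); apply: eq_card => v.
rewrite !inE /= scaler_nat andbC; case: eqP => //= v0; apply/eqP.
by rewrite mulmxMnr -mulmxMnl v0 mul0mx.
Qed.

(* The rows of [B] lift a basis of the radical modulo [p]. *)
Lemma radical_basis n (S : 'M[R]_n) :
  exists (t : nat) (B : 'M[R]_(t, n)) (D : 'M[R]_(n, t)),
    [/\ B *m D = 1%:M, B *m S = 0,
        forall v : 'rV[R]_n, v *m S = 0 -> exists u z, v = u *m B + z *+ p,
        (t <= n)%N & (form_size S * p ^ t)%N = (form_size (S *+ p) * p ^ n)%N].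
Proof.
(* [K] is the radical modulo [p]. It is a subspace, so it coincides with the span [Q] of its
   elements, and [t] is the dimension of [Q]. *)
pose K := [set map_mx red v | v in radical S]%SET : {set 'rV['F_p]_n}.
pose Q := (\sum_(w in K) <<w>>)%MS.
have KQ w : (w \in K) = (w <= Q)%MS.
  apply/idP/idP => [Kw|/sub_sumsmxP[u ->]].
    by apply: (submx_trans _ (sumsmx_sup w Kw (submx_refl _))); rewrite genmxE.
  have K0 : 0 \in K by apply/imsetP; exists 0; rewrite ?map_mx0// inE mul0mx.
  have KD x y : x \in K -> y \in K -> x + y \in K.
    move=> /imsetP[v + ->] /imsetP[v' + ->]; rewrite !inE => /eqP vS /eqP v'S.
    apply/imsetP; exists (v + v'); last by rewrite map_mxD.
    by rewrite inE mulmxDl vS v'S addr0.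
  have KZ a x : x \in K -> a *: x \in K.
    move=> /imsetP[v + ->]; rewrite !inE => /eqP vS.
    apply/imsetP; exists (lift_Fp a *: v); last by rewrite map_mxZ /= lift_FpK.
    by rewrite inE -scalemxAl vS scaler0.
  elim/big_ind: _ => // w' Kw'.
  have /sub_rVP[a ->] : (u w' *m <<w'>> <= w')%MS.
    by rewrite (submx_trans (submxMl _ _))// genmxE.
  exact: KZ.
have ex (i : 'I_(\rank Q)) :
    exists v : 'rV[R]_n, (v \in radical S) && (map_mx red v == row i (row_base Q)).
  have : row i (row_base Q) \in K.
    by rewrite KQ (submx_trans (row_sub _ _))// eq_row_base.
  by move=> /imsetP[v vS ->]; exists v; rewrite vS eqxx.
pose B := \matrix_i xchoose (ex i).
have BE : map_mx red B = row_base Q.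
  apply/row_matrixP => i; rewrite -map_row rowK.
  by have /andP[_ /eqP] := xchooseP (ex i).
have BS : B *m S = 0.
  apply/row_matrixP => i; rewrite row_mul rowK row0.
  by have /andP[+ _] := xchooseP (ex i); rewrite inE => /eqP.
(* A right inverse modulo [p] lifts to [D0], with [B *m D0] invertible over [R] because it is so
   modulo [p]; this is then corrected to an exact right inverse of [B]. *)
have /row_freeP[D' D'E] := row_base_free Q.
pose D0 := map_mx lift_Fp D'.
have uBD : B *m D0 \in unitmx.
  by apply: red_unitmx; rewrite map_mxM BE lift_mxK D'E unitmx1.
exists (\rank Q), B, (D0 *m invmx (B *m D0)); split=> //.
- by rewrite mulmxA mulmxV.
- move=> v vS; have : (map_mx red v <= row_base Q)%MS.
    by rewrite eq_row_base -KQ; apply/imsetP; exists v; rewrite // inE vS.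
  move=> /submxP[u uE]; exists (map_mx lift_Fp u).
  have : (v - map_mx lift_Fp u *m B) *+ p ^ M = 0.
    by apply/eqP; rewrite -red_mx_eq0 map_mxB map_mxM BE lift_mxK uE subrr.
  by move=> /mulrn_pquo[z zE]; exists z; rewrite -zE addrCA subrr addr0.
- exact: rank_leq_col.
have cK : #|K| = (p ^ \rank Q)%N.
  have -> : (p ^ \rank Q)%N = #|{: 'rV['F_p]_(\rank Q)}|.
    by rewrite card_mx card_Fp// mul1n.
  have inj : injective (fun u : 'rV_(\rank Q) => u *m row_base Q).
    exact: row_free_inj (row_base_free Q).
  rewrite -(card_imset _ inj).
  apply: eq_card => w; rewrite KQ -(eq_row_base Q).
  by apply/submxP/imsetP => [[u ->]|[u _ ->]]; exists u.
(* Reduction modulo [p] splits the order of the radical of [S] into [#|K|] and the number of its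
   elements divisible by [p]. The latter also occurs in [card_radical_mulp] and cancels. *)
have rS : #|radical S| =
    (p ^ \rank Q * #|[set v in radical S | (v *+ p ^ M == 0)%R]%SET|)%N.
  rewrite (@card_additive_image _ _ (map_mx red : {additive 'rV[R]_n -> 'rV['F_p]_n})
    (radical S)) ?inE ?mul0mx//; last exact: radicalB.
  by rewrite cK; congr (_ * _)%N; apply: eq_card => v; rewrite !inE red_mx_eq0.
have := form_size_radical S; rewrite -(form_size_radical (S *+ p)).
rewrite card_radical_mulp rS mulnA [RHS]mulnA [RHS]mulnAC => /eqP.
rewrite eqn_pmul2r => [/eqP//|]; rewrite card_gt0; apply/set0Pn; exists 0.
by rewrite !inE mul0mx mul0rn !eqxx.
Qed.

Lemma radical_rank n (S : 'M[R]_n) t :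
  (t <= n)%N -> (form_size S * p ^ t)%N = (form_size (S *+ p) * p ^ n)%N ->
  form_rank S = (n - t)%N /\ form_size S = (form_size (S *+ p) * p ^ form_rank S)%N.
Proof.
move=> tn; have -> : (p ^ n = p ^ (n - t) * p ^ t)%N by rewrite -expnD subnK.
rewrite mulnA => /eqP.
rewrite eqn_pmul2r ?expn_gt0 ?p_gt0// => /eqP SE.
have rkE : form_rank S = (n - t)%N.
  by rewrite /form_rank SE mulKn ?form_size_gt0// pfactorK.
by rewrite rkE.
Qed.

Lemma form_rank_leq n (S : 'M[R]_n) : (form_rank S <= n)%N.
Proof.
have [t [B [D [_ _ _ tn st]]]] := radical_basis S.
by have [-> _] := radical_rank tn st; exact: leq_subr.
Qed.

Lemma form_sizeE n (S : 'M[R]_n) :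
  form_size S = (form_size (S *+ p) * p ^ form_rank S)%N.
Proof.
have [t [B [D [_ _ _ tn st]]]] := radical_basis S.
by have [_] := radical_rank tn st.
Qed.

(** The corank is the dimension [t] of the radical modulo [p]. If [t] is positive, the first row of
    [B] lies in the radical and is nonzero modulo [p], as [B] has a right inverse. *)
Lemma full_form_rank n (S : 'M[R]_n) : full_form S = (form_rank S == n).
Proof.
have [t [B [D [BD BS Bspan tn st]]]] := radical_basis S.
have [-> _] := radical_rank tn st.
have -> : (n - t == n)%N = (t == 0%N) by lia.
apply/full_formP/eqP => [h|t0 v vS].
  case: t B D BD BS {Bspan tn st} => // t B D BD BS.
  have := h (delta_mx 0 0 *m B); rewrite -mulmxA BS mulmx0 => /(_ erefl).
  move=> /(congr1 (mulmx^~ D)); rewrite mulmxMnl -mulmxA BD mulmx1 mul0mx.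
  move=> /eqP; rewrite -red_mx_eq0 => /eqP/matrixP/(_ 0 0)/eqP.
  by rewrite !mxE !eqxx rmorph1 oner_eq0.
have [u [z ->]] := Bspan v vS; subst t.
by rewrite flatmx0 mulmx0 add0r mulrn_p_torsion.
Qed.

(** * Lifts of a symmetric form along multiplication by [p] *)

Definition sym_torsion n : {set 'M[R]_n} :=
  [set X : 'M[R]_n | (X^T == X) && (X *+ p == 0)]%SET.

Lemma sym_torsionB n : {in sym_torsion n &, forall X Y, X - Y \in sym_torsion n}.
Proof.
move=> X Y; rewrite !inE => /andP[/eqP sX /eqP X0] /andP[/eqP sY /eqP Y0].
by rewrite linearB /= sX sY mulrnBl X0 Y0 subrr !eqxx.
Qed.

Lemma sym_torsion0 n : 0 \in sym_torsion n.
Proof. by rewrite inE trmx0 mul0rn !eqxx. Qed.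

(** These matrices stand for the symmetric matrices over [F_p], scaled by [p ^ M]. The induction
    splits off the corner entry and the rest of the first row. *)
Lemma card_sym_torsion n : #|sym_torsion n| = (p ^ 'C(n.+1, 2))%N.
Proof.
elim: n => [|n IHn].
  rewrite bin_small//; apply/eqP; rewrite expn0 eqn_leq; apply/andP; split.
    by rewrite (leq_trans (max_card _))// card_mx muln0.
  by apply/card_gt0P; exists 0; exact: sym_torsion0.
rewrite binS bin1 expnD -IHn.
pose T n := [set A : 'M[R]_(1, n) | A *+ p == 0]%SET.
pose f (x : 'M[R]_1 * 'rV[R]_n * 'M[R]_n) : 'M[R]_(1 + n) :=
  block_mx x.1.1 x.1.2 x.1.2^T x.2.
have f_inj : injective f.
  by move=> [[a u] X] [[a' u'] X'] /eq_block_mx[/= -> -> _ ->].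
have -> : (p ^ n.+1 = p ^ (1 * 1) * p ^ (1 * n))%N by rewrite -expnD !mul1n.
rewrite -(card_torsion_p 1 1) -(card_torsion_p 1 n) -/(T 1%N) -/(T n).
have symP (S : 'M[R]_(1 + n)) : S^T = S -> S *+ p = 0 ->
    exists2 x, x \in finset.setX (finset.setX (T 1%N) (T n)) (sym_torsion n) & S = f x.
  rewrite -[S]submxK tr_block_mx => /eq_block_mx[_ _ sur sdr] S0.
  have {}S0 i j := congr1 (fun A : 'M[R]_(1 + n) => A i j) S0.
  exists (ulsubmx S, ursubmx S, drsubmx S); last by rewrite /f /= sur.
  rewrite !inE /= sdr eqxx /=; apply/andP; split; [apply/andP; split|].
  - apply/eqP/matrixP => i j; have := S0 (lshift n i) (lshift n j).
    by rewrite !mulmxnE block_mxEul !mxE.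
  - apply/eqP/matrixP => i j; have := S0 (lshift n i) (rshift 1 j).
    by rewrite !mulmxnE block_mxEur !mxE.
  - apply/eqP/matrixP => i j; have := S0 (rshift 1 i) (rshift 1 j).
    by rewrite !mulmxnE block_mxEdr !mxE.
have fP x : x \in finset.setX (finset.setX (T 1%N) (T n)) (sym_torsion n) ->
    (f x)^T = f x /\ f x *+ p = 0.
  case: x => [[a u] X].
  rewrite !inE /= => /andP[/andP[/eqP a0 /eqP u0] /andP[/eqP sX /eqP X0]].
  rewrite /f /= tr_block_mx trmxK sX; split.
    by congr block_mx; apply/matrixP => i j; rewrite !mxE !ord1.
  apply/matrixP => i j; rewrite mulmxnE [RHS]mxE.
  case: (split_ordP i) => i' ->; case: (split_ordP j) => j' ->.
  - by rewrite block_mxEul -mulmxnE a0 mxE.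
  - by rewrite block_mxEur -mulmxnE u0 mxE.
  - by rewrite block_mxEdl mxE -mulmxnE u0 mxE.
  - by rewrite block_mxEdr -mulmxnE X0 mxE.
rewrite mulnC -!cardsX -(card_imset _ f_inj).
apply: eq_card => S; rewrite inE; apply/andP/imsetP => [[/eqP sS /eqP S0]|].
  exact: symP.
by move=> [x /fP[sx x0] ->]; split; apply/eqP.
Qed.

(** The number of nondegenerate symmetric bilinear forms on [F_p^n], again scaled by [p ^ M]. *)
Definition full_count n : nat := #|[set X in sym_torsion n | full_form X]%SET|.

Lemma mul_annihilator n (S : 'M[R]_n) (c : 'rV[R]_n) : S^T = S ->
  (forall v : 'rV[R]_n, v *m S = 0 -> c *m v^T = 0) -> exists w, c = w *m S.
Proof.
move=> sS Sc; have [v vS|w wE] := @annihilator_column _ _ S c^T.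
  by apply: trmx_inj; rewrite trmx_mul trmxK Sc// trmx0.
by exists w^T; apply: trmx_inj; rewrite trmx_mul sS trmxK.
Qed.

(* [B *m S *m B^T] is the form induced by [S] on the radical of [p S] modulo
   [p]. *)
Lemma full_form_restrict n t (S : 'M[R]_n) (B : 'M[R]_(t, n)) (D : 'M[R]_(n, t)) :
  S^T = S -> B *m D = 1%:M -> B *m (S *+ p) = 0 ->
  (forall v : 'rV[R]_n, v *m (S *+ p) = 0 -> exists u z, v = u *m B + z *+ p) ->
  full_form (B *m S *m B^T) = full_form S.
Proof.
move=> sS BD BS Bspan.
have SB : (S *+ p) *m B^T = 0.
  by apply: trmx_inj; rewrite trmx_mul trmxK linearMn /= sS BS trmx0.
apply/full_formP/full_formP => [fB v vS|fS u uB].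
  have vSp : v *m (S *+ p) = 0 by rewrite mulmxMnr vS mul0rn.
  have [u [z vE]] := Bspan v vSp.
  have uBSB : u *m (B *m S *m B^T) = 0.
    have -> : u *m (B *m S *m B^T) = v *m S *m B^T - (z *+ p) *m S *m B^T.
      by rewrite vE -mulmxBl -mulmxBl addrK !mulmxA.
    by rewrite vS mul0mx mulmxMnl -mulmxMnr -mulmxA SB mulmx0 subrr.
  by rewrite vE mulrnDl mulrn_p_torsion addr0 -mulmxMnl fB ?mul0mx.
have uBrad : u *m B *m (S *+ p) = 0 by rewrite -mulmxA BS mulmx0.
(* The row [u B S] pairs to zero with the radical of [p S], by the spanning hypothesis, so the
   double annihilator property makes it a combination of the rows of [p S]. Then [u B - p w] lies in
   the radical of [S]. *)
have [w wE] : exists w, u *m B *m S = w *m (S *+ p).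
  apply: mul_annihilator => [|v /Bspan[u' [z ->]]]; first by rewrite linearMn /= sS.
  rewrite linearD linearMn /= trmx_mul mulmxDr mulmxMnr mulmxA.
  have -> : u *m B *m S *m B^T = 0 by rewrite -uB !mulmxA.
  by rewrite mul0mx add0r -mulmxMnl -mulmxMnr uBrad mul0mx.
have /fS : (u *m B - w *+ p) *m S = 0.
  by rewrite mulmxBl wE mulmxMnl mulmxMnr subrr.
rewrite mulrnBl mulrn_p_torsion subr0 => uB0.
by rewrite -[u]mulmx1 -BD mulmxA -mulmxMnl uB0 mul0mx.
Qed.

(** Restriction [X |-> B X B^T] to the radical of [S] modulo [p] sends the full lifts of [S] onto
    the nondegenerate forms in dimension [t = n - form_rank S]. Its fibres are translates of its
    kernel on [sym_torsion n], whose order follows from the surjection of [sym_torsion n] onto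
    [sym_torsion t]. *)
Lemma card_full_lifts n (S : 'M[R]_n) : S^T = S -> S *+ p ^ M = 0 ->
  (#|[set X : 'M[R]_n | [&& (X^T == X)%R, (X *+ p == S)%R & full_form X]]%SET|
     * p ^ 'C((n - form_rank S).+1, 2))%N =
  (full_count (n - form_rank S) * p ^ 'C(n.+1, 2))%N.
Proof.
move=> sS S0; pose S1 := map_mx pquo S.
have S1p : S1 *+ p = S by exact: pquo_mxK.
have sS1 : S1^T = S1 by rewrite /S1 map_trmx sS.
have [t [B [D [BD BS Bspan tn st]]]] := radical_basis S.
have [-> _] := radical_rank tn st; rewrite subKn//.
pose f (X : 'M[R]_n) := B *m X *m B^T.
have fB : zmod_morphism f by move=> X Y; rewrite /f mulmxBr mulmxBl.
pose f' : {additive 'M[R]_n -> 'M[R]_t} :=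
  HB.pack f (GRing.isZmodMorphism.Build _ _ f fB).
have fsym X : X^T = X -> (f X)^T = f X.
  by move=> sX; rewrite /f !trmx_mul trmxK sX mulmxA.
have fp X : X *+ p = S -> f X *+ p = 0.
  by move=> Xp; rewrite /f -mulmxMnl -mulmxMnr Xp BS mul0mx.
have fD X Y : f (X + Y) = f X + f Y := raddfD f' X Y.
have fDK Z : f (D *m Z *m D^T) = Z.
  by rewrite /f !mulmxA BD mul1mx -mulmxA -trmx_mul BD trmx1 mulmx1.
set L := finset _.
have imL : [set f' X | X in L]%SET = [set Y in sym_torsion t | full_form Y]%SET.
  apply/setP => Y; rewrite inE; apply/imsetP/andP => [[X]|[]].
    rewrite !inE => /and3P[/eqP sX /eqP Xp fX] ->.
    rewrite fsym// fp// !eqxx /= (full_form_restrict sX BD)// ?Xp//.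
  rewrite inE => /andP[/eqP sY /eqP Y0] fY.
  (* The lift [S1] is symmetric but restricts to [f S1]; as [f (D Z D^T) = Z], the added term
     changes the restriction to [Y], and it is killed by [p]. *)
  pose X := S1 + D *m (Y - f S1) *m D^T.
  have sX : X^T = X.
    by rewrite /X linearD /= sS1 !trmx_mul trmxK linearB /= sY fsym// mulmxA.
  have Xp : X *+ p = S.
    rewrite /X mulrnDl S1p -mulmxMnl -mulmxMnr mulrnBl Y0 fp// subrr.
    by rewrite mulmx0 mul0mx addr0.
  have fX : f X = Y.
    by rewrite /X fD fDK addrCA subrr addr0.
  exists X => //; rewrite inE sX Xp !eqxx /=.
  by rewrite -(full_form_restrict sX BD) ?Xp// -/(f X) fX.
pose K0 := [set X in sym_torsion n | f' X == 0]%SET; pose k := #|K0|.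
have -> : #|L| = (full_count t * k)%N.
  rewrite /full_count -imL; apply: card_fibers => X.
  rewrite inE => /and3P[/eqP sX /eqP Xp fX].
  rewrite /k -(card_imset (mem K0) (addrI X)); apply: eq_card => Y.
  rewrite !inE; apply/andP/imsetP => [[/and3P[/eqP sY /eqP Yp fY] /eqP fYX]|[Z]].
    exists (Y - X); last by rewrite addrCA subrr addr0.
    rewrite !inE linearB /= sX sY mulrnBl Xp Yp subrr !eqxx /= fB subr_eq0.
    exact/eqP.
  rewrite !inE => /andP[/andP[/eqP sZ /eqP Z0] /eqP fZ] YE.
  have sY : Y^T = Y by rewrite YE linearD /= sX sZ.
  have Yp : Y *+ p = S by rewrite YE mulrnDl Xp Z0 addr0.
  have fYX : f Y = f X by rewrite YE fD [f Z]fZ addr0.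
  rewrite sY Yp -[f' Y]/(f Y) fYX !eqxx /=; split=> //.
  rewrite -(full_form_restrict sY BD) ?Yp// -/(f Y) fYX.
  by rewrite /f (full_form_restrict sX BD) ?Xp.
rewrite -(card_sym_torsion n) -(card_sym_torsion t).
rewrite (card_additive_image f' (sym_torsion0 n) (@sym_torsionB n)) -/K0 -/k.
rewrite mulnAC mulnA; congr (_ * _ * _)%N.
apply: eq_card => Y; apply/idP/imsetP => [|[X]].
  rewrite inE => /andP[/eqP sY /eqP Y0]; exists (D *m Y *m D^T).
    rewrite inE !trmx_mul trmxK sY mulmxA -mulmxMnl -mulmxMnr Y0.
    by rewrite mulmx0 mul0mx !eqxx.
  by rewrite /= fDK.
rewrite !inE => /andP[/eqP sX /eqP X0] ->; rewrite fsym// /= /f.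
by rewrite -mulmxMnl -mulmxMnr X0 mulmx0 mul0mx !eqxx.
Qed.

(** * Gram matrices *)

Local Open Scope quotient_scope.

Definition QZ (q : rat) : QmodZ := \pi_QmodZ q.

Let QZ_zmod : zmod_morphism QZ.
Proof. exact: (raddfB (\pi_QmodZ)). Qed.

HB.instance Definition _ := GRing.isZmodMorphism.Build rat QmodZ QZ QZ_zmod.

Lemma QZ_eq0 (q : rat) : (QZ q == 0) = (q \is a Num.int).
Proof.
rewrite -[0](raddf0 QZ) /QZ.
by have := Quotient.idealrBE (GRing.ZmodClosed.clone rat Num.int_num_subdef _) q 0;
   rewrite subr0 => <-.
Qed.

Lemma QZ_surj (x : QmodZ) : exists q, x = QZ q.
Proof. by exists (generic_quotient.repr x); rewrite /QZ reprK. Qed.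

Definition to_QmodZ (a : R) : QmodZ := QZ ((a : nat)%:R / N%:R).

Let N_neq0 : N%:R != 0 :> rat.
Proof. by rewrite pnatr_eq0 -lt0n ltnW. Qed.

Let to_QmodZ_nat (n : nat) : to_QmodZ n%:R = QZ (n%:R / N%:R).
Proof.
apply/eqP; rewrite /to_QmodZ val_Zp_nat// eq_sym -subr_eq0 -raddfB QZ_eq0.
rewrite {1}(divn_eq n N) natrD natrM mulrDl mulfK// addrK.
exact: intr_nat.
Qed.

Let to_QmodZ_zmod : zmod_morphism to_QmodZ.
Proof.
move=> a b; have bN : (b <= N)%N by rewrite ltnW// -[ltnRHS](Zp_cast N_gt1) ltn_ord.
have -> : a - b = (a + (N - b))%:R.
  by rewrite natrD natrB// pchar_Zp// sub0r -!Zpk_natE.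
rewrite to_QmodZ_nat natrD natrB// addrCA mulrDl divff// raddfD mulrBl raddfB /=.
have -> : QZ 1 = 0 by apply/eqP; rewrite QZ_eq0.
by rewrite add0r.
Qed.

HB.instance Definition _ := GRing.isZmodMorphism.Build R QmodZ to_QmodZ to_QmodZ_zmod.

Lemma to_QmodZ_inj : injective to_QmodZ.
Proof.
apply: raddf_inj => a; rewrite /to_QmodZ => /eqP; rewrite QZ_eq0 => /intrP[z zE].
apply/eqP; rewrite [a]Zpk_natE Zpk_nat_eq0.
have : Posz a = z * Posz N.
  by apply: (@intr_inj rat); rewrite intrM -zE -!pmulrn divfK.
by move=> /(congr1 absz); rewrite abszM /= => ->; exact: dvdn_mull.
Qed.

Lemma to_QmodZM (a b : R) : to_QmodZ (a * b) = to_QmodZ a *+ b.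
Proof. by rewrite {1}[b]Zpk_natE mulr_natr raddfMn. Qed.

Lemma to_QmodZ_torsion (x : QmodZ) : x *+ N = 0 -> exists a, to_QmodZ a == x.
Proof.
have [q ->] := QZ_surj x => /eqP; rewrite -raddfMn QZ_eq0 => /intrP[z zE].
exists z%:~R; apply/eqP.
have -> : q = z%:~R / N%:R by rewrite -zE -(mulr_natr q) mulfK.
case: z {zE} => n; first by rewrite -pmulrn to_QmodZ_nat.
by rewrite NegzE !mulrNz -!pmulrn mulNr !raddfN /= to_QmodZ_nat.
Qed.

(** The inverse of the embedding [a |-> a / N] on the [N]-torsion of Q/Z; elsewhere it takes the
    default value 0. *)
Definition of_QmodZ (x : QmodZ) : R := odflt 0 [pick a | to_QmodZ a == x].

Lemma of_QmodZK (x : QmodZ) : x *+ N = 0 -> to_QmodZ (of_QmodZ x) = x.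
Proof.
move=> /to_QmodZ_torsion[a ax]; rewrite /of_QmodZ; case: pickP => [b /eqP//|/(_ a)].
by rewrite ax.
Qed.

Lemma to_QmodZK : cancel to_QmodZ of_QmodZ.
Proof.
move=> a; rewrite /of_QmodZ; case: pickP => [b /eqP/to_QmodZ_inj//|/(_ a)].
by rewrite eqxx.
Qed.

Local Close Scope quotient_scope.

(** * Generating tuples and the relations between their members *)

Definition killed (k : nat) (A : finZmodType) := forall x : A, x *+ p ^ k = 0.

Section LinearCombinations.
Variable A : finZmodType.
Hypothesis A_killed : killed M.+1 A.

Let mulrn_Zpk_nat (x : A) (n : nat) : x *+ (n%:R : R) = x *+ n.
Proof.
by rewrite val_Zp_nat// {2}(divn_eq n N) mulrnDr mulnC mulrnA A_killed mul0rn add0r.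
Qed.

Let mulrn_ZpkD (x : A) (a b : R) : x *+ (a + b)%R = x *+ a + x *+ b.
Proof. by rewrite {1}[a]Zpk_natE {1}[b]Zpk_natE -natrD mulrn_Zpk_nat mulrnDr. Qed.

Let mulrn_ZpkM (x : A) (a b : R) : x *+ (a * b)%R = x *+ b *+ a.
Proof. by rewrite {1}[a]Zpk_natE {1}[b]Zpk_natE -natrM mulrn_Zpk_nat mulnC mulrnA. Qed.

(** Scalars of [R] act through their natural representatives; this is a module action because [A] is
    killed by [N]. *)
Definition lincomb n (e : {ffun 'I_n -> A}) (v : 'rV[R]_n) : A :=
  \sum_i e i *+ v 0 i.

Lemma lincomb_zmod n (e : {ffun 'I_n -> A}) : zmod_morphism (lincomb e).
Proof.
have D v w : lincomb e (v + w) = lincomb e v + lincomb e w.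
  by rewrite -big_split; apply: eq_bigr => i _; rewrite mxE mulrn_ZpkD.
by move=> v w; apply/eqP; rewrite -[_ == _](inj_eq (addIr (lincomb e w))) -D !subrK.
Qed.

Definition lincomb_additive n (e : {ffun 'I_n -> A}) : {additive 'rV[R]_n -> A} :=
  HB.pack (lincomb e) (GRing.isZmodMorphism.Build _ _ (lincomb e) (lincomb_zmod e)).

Lemma lincombZ n (e : {ffun 'I_n -> A}) a v : lincomb e (a *: v) = lincomb e v *+ a.
Proof.
by rewrite -sumrMnl; apply: eq_bigr => i _; rewrite mxE mulrn_ZpkM.
Qed.

Lemma lincombMn n (e : {ffun 'I_n -> A}) v k : lincomb e (v *+ k) = lincomb e v *+ k.
Proof. exact: (raddfMn (lincomb_additive e)). Qed.

Lemma lincomb_delta n (e : {ffun 'I_n -> A}) i : lincomb e (delta_mx 0 i) = e i.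
Proof.
rewrite /lincomb (bigD1 i)//= big1 ?addr0 ?mxE ?eqxx// => j ji.
by rewrite mxE (negPf ji).
Qed.

Lemma lincomb_mul m n (f : {ffun 'I_n -> A}) (C : 'M[R]_(m, n)) (u : 'rV[R]_m) :
  lincomb [ffun i => lincomb f (row i C)] u = lincomb f (u *m C).
Proof.
rewrite mulmx_sum_row -[RHS]/(lincomb_additive f _) raddf_sum; apply: eq_bigr => i _.
by rewrite ffunE /= lincombZ.
Qed.

Definition generating n (e : {ffun 'I_n -> A}) : bool :=
  [forall x, exists v, lincomb e v == x].

Lemma generatingP n (e : {ffun 'I_n -> A}) :
  reflect (forall x, exists v, lincomb e v = x) (generating e).
Proof. exact: 'forall_'exists_eqP. Qed.

Variable d : A -> A -> QmodZ.
Hypothesis dd : duality_pairing d.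

Let d0l y : d 0 y = 0.
Proof. by apply: (addrI (d 0 y)); rewrite -(pairingDl dd) !addr0. Qed.

Let d_sum I (r : seq I) (F : I -> A) y : d (\sum_(i <- r) F i) y = \sum_(i <- r) d (F i) y.
Proof.
by elim/big_rec2: _ => [|i x z _ <-]; rewrite ?d0l ?(pairingDl dd).
Qed.

Let dMl x y k : d (x *+ k) y = d x y *+ k.
Proof. by elim: k => [|k IHk]; rewrite ?mulr0n ?d0l// !mulrS (pairingDl dd) IHk. Qed.

Definition gram n (e : {ffun 'I_n -> A}) : 'M[R]_n :=
  \matrix_(i, j) of_QmodZ (d (e i) (e j)).

Let gramE n (e : {ffun 'I_n -> A}) i j : to_QmodZ (gram e i j) = d (e i) (e j).
Proof. by rewrite mxE of_QmodZK// -dMl A_killed d0l. Qed.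

Lemma gram_sym n (e : {ffun 'I_n -> A}) : (gram e)^T = gram e.
Proof. by apply/matrixP => i j; rewrite !mxE (pairing_sym dd). Qed.

Lemma pairing_lincomb n (e : {ffun 'I_n -> A}) v w :
  d (lincomb e v) (lincomb e w) = to_QmodZ ((v *m gram e *m w^T) 0 0).
Proof.
rewrite d_sum mxE (eq_bigr (fun j => \sum_i v 0 i * gram e i j * w 0 j)); last first.
  by move=> j _; rewrite !mxE big_distrl.
rewrite exchange_big raddf_sum; apply: eq_bigr => i _ /=.
rewrite dMl (pairing_sym dd) d_sum raddf_sum -sumrMnl; apply: eq_bigr => j _ /=.
rewrite dMl (pairing_sym dd (e j)).
have -> : v 0 i * gram e i j * w 0 j = gram e i j * w 0 j * v 0 i.
  by rewrite -mulrA mulrC.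
by rewrite !to_QmodZM gramE.
Qed.

(** The pairing is nondegenerate and [e] generates, so an element vanishes exactly when it pairs to
    zero with every [e j]. The relations between the generators are therefore the radical of the
    Gram matrix. *)
Lemma lincomb_eq0 n (e : {ffun 'I_n -> A}) v : generating e ->
  (lincomb e v == 0) = (v *m gram e == 0).
Proof.
move=> /generatingP ge; apply/eqP/eqP => [v0|vG].
  apply/rowP => j; rewrite [RHS]mxE; apply: to_QmodZ_inj; rewrite raddf0.
  have := pairing_lincomb e v (delta_mx 0 j); rewrite v0 d0l => ->.
  by rewrite trmx_delta -colE [in RHS]mxE.
apply: (pairing_inj dd) => x; have [w <-] := ge x.
by rewrite pairing_lincomb vG mul0mx mxE raddf0 d0l.
Qed.

Lemma lincomb_eq n (e : {ffun 'I_n -> A}) v w : generating e ->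
  (lincomb e v == lincomb e w) = (v *m gram e == w *m gram e).
Proof.
move=> ge; rewrite -subr_eq0 -lincomb_zmod lincomb_eq0// mulmxBl subr_eq0//.
Qed.

Lemma card_gram n (e : {ffun 'I_n -> A}) : generating e -> #|A| = form_size (gram e).
Proof.
move=> ge; apply/eqP; rewrite -(@eqn_pmul2r #|radical (gram e)|); last first.
  by apply/card_gt0P; exists 0; rewrite inE mul0mx.
rewrite form_size_radical; apply/eqP/esym.
have := @card_additive_image _ _ (lincomb_additive e) [set: 'rV[R]_n]%SET
  (finset.in_setT _) (fun x y _ _ => finset.in_setT _).
rewrite cardsT card_mx card_Zpk// mul1n => ->; congr (_ * _)%N.
  rewrite -cardsT; apply: eq_card => x; rewrite !inE; apply/imsetP.
  by have /generatingP/(_ x)[v <-] := ge; exists v.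
by apply: eq_card => x; rewrite !inE lincomb_eq0.
Qed.

Lemma card_pmultiples_gram n (e : {ffun 'I_n -> A}) : generating e ->
  #|pmultiples p A| = form_size (gram e *+ p).
Proof.
move=> ge; apply/eqP; rewrite -(@eqn_pmul2r #|radical (gram e *+ p)|); last first.
  by apply/card_gt0P; exists 0; rewrite inE mul0mx.
rewrite form_size_radical; apply/eqP/esym.
have fz : zmod_morphism (fun v => lincomb e v *+ p).
  by move=> v w; rewrite lincomb_zmod mulrnBl.
pose f : {additive 'rV[R]_n -> A} :=
  HB.pack (fun v => lincomb e v *+ p) (GRing.isZmodMorphism.Build _ _ _ fz).
have := @card_additive_image _ _ f [set: 'rV[R]_n]%SET
  (finset.in_setT _) (fun x y _ _ => finset.in_setT _).
rewrite cardsT card_mx card_Zpk// mul1n => ->; congr (_ * _)%N.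
  apply: eq_card => x; apply/imsetP/imsetP => [[v _ ->]|[y _ ->]].
    by exists (lincomb e v).
  by have /generatingP/(_ y)[v <-] := ge; exists v.
by apply: eq_card => x; rewrite !inE /= -lincombMn lincomb_eq0// mulmxMnl mulmxMnr.
Qed.

Lemma prank_gram n (e : {ffun 'I_n -> A}) : generating e ->
  prank p A = form_rank (gram e).
Proof.
by move=> ge; rewrite /prank card_pquotient (card_gram ge) (card_pmultiples_gram ge).
Qed.

Lemma killed_gram n (e : {ffun 'I_n -> A}) k : generating e ->
  killed k A <-> gram e *+ p ^ k = 0.
Proof.
move=> ge; split=> [Ak|Gk x].
  apply/row_matrixP => i; rewrite row0 rowE mulmxMnr -mulmxMnl; apply/eqP.
  by rewrite -lincomb_eq0// lincombMn Ak.
have /generatingP/(_ x)[v <-] := ge.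
by apply/eqP; rewrite -lincombMn lincomb_eq0// mulmxMnl -mulmxMnr Gk mulmx0.
Qed.

End LinearCombinations.

(** * The Gram matrix as a complete invariant of a pair with a generating tuple *)

Lemma pairing_AutP (A : finZmodType) (d : A -> A -> QmodZ) (a : {perm A}) :
  a \in pairing_Aut d <->
  (forall x y, a (x + y) = a x + a y) /\ (forall x y, d (a x) (a y) = d x y).
Proof.
rewrite inE; split.
  move=> /andP[]; rewrite inE => /andP[_ /morphicP am] /'forall_'forall_eqP ad.
  by split=> // x y; exact: am.
move=> [am ad]; apply/andP; split; last exact/'forall_'forall_eqP.
rewrite inE; apply/andP; split; first by apply/fintype.subsetP => x; rewrite !inE.
by apply/morphicP => x y _ _; exact: am.
Qed.

Lemma additive_lincomb (A B : finZmodType) (f : A -> B) n (e : {ffun 'I_n -> A}) v :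
  {morph f : x y / x + y} -> f (lincomb e v) = lincomb [ffun i => f (e i)] v.
Proof.
move=> fD; have f0 : f 0 = 0 by apply: (addrI (f 0)); rewrite -fD !addr0.
rewrite /lincomb; elim/big_rec2: _ => // i x y _ <-; rewrite fD ffunE; congr (_ + _).
by elim: (nat_of_ord _) => [|k IHk]; rewrite ?mulr0n// !mulrS fD IHk.
Qed.

(** Equal Gram matrices mean equal relations, so sending the combination of [e] with coefficients
    [v] to that of [e'] is well defined in both directions. *)
Lemma gram_iso (A B : finZmodType) (kA : killed M.+1 A) (kB : killed M.+1 B)
    (dA : A -> A -> QmodZ) (dB : B -> B -> QmodZ)
    (ddA : duality_pairing dA) (ddB : duality_pairing dB)
    n (e : {ffun 'I_n -> A}) (e' : {ffun 'I_n -> B}) :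
  generating e -> generating e' -> gram dA e = gram dB e' ->
  exists f : {additive A -> B},
    [/\ bijective f, forall x y, dB (f x) (f y) = dA x y & forall i, f (e i) = e' i].
Proof.
move=> ge ge' eG.
have ex x : exists v, lincomb e v == x by have /generatingP/(_ x)[v <-] := ge; exists v.
have ex' y : exists v, lincomb e' v == y by have /generatingP/(_ y)[v <-] := ge'; exists v.
pose f x := lincomb e' (xchoose (ex x)); pose g y := lincomb e (xchoose (ex' y)).
have fE v : f (lincomb e v) = lincomb e' v.
  apply/eqP; rewrite /f (lincomb_eq kB ddB)// -eG -(lincomb_eq kA ddA)//.
  exact: xchooseP (ex _).
have gE v : g (lincomb e' v) = lincomb e v.
  apply/eqP; rewrite /g (lincomb_eq kA ddA)// eG -(lincomb_eq kB ddB)//.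
  exact: xchooseP (ex' _).
have fz : zmod_morphism f.
  move=> x y; rewrite -(eqP (xchooseP (ex x))) -(eqP (xchooseP (ex y))).
  by rewrite -lincomb_zmod// !fE lincomb_zmod.
pose f' : {additive A -> B} := HB.pack f (GRing.isZmodMorphism.Build _ _ f fz).
exists f'; split=> [|x y|i].
- exists g => [x|y].
    by rewrite -(eqP (xchooseP (ex x))) /= fE gE.
  by rewrite -(eqP (xchooseP (ex' y))) /= gE fE.
- rewrite -(eqP (xchooseP (ex x))) -(eqP (xchooseP (ex y))) /= !fE.
  by rewrite (pairing_lincomb kA ddA) (pairing_lincomb kB ddB) eG.
- by rewrite -(lincomb_delta kA e i) /= fE lincomb_delta.
Qed.

Lemma gram_morph (A B : finZmodType) (dA : A -> A -> QmodZ) (dB : B -> B -> QmodZ)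
    (f : A -> B) n (e : {ffun 'I_n -> A}) :
  (forall x y, dB (f x) (f y) = dA x y) ->
  gram dB [ffun i => f (e i)] = gram dA e.
Proof. by move=> fd; apply/matrixP => i j; rewrite !mxE !ffunE fd. Qed.

Lemma generating_morph (A B : finZmodType) (f : {additive A -> B}) n
    (e : {ffun 'I_n -> A}) :
  bijective f -> generating e -> generating [ffun i => f (e i)].
Proof.
move=> [g fK gK] /generatingP ge; apply/generatingP => y.
have [v vE] := ge (g y); exists v.
by rewrite -(additive_lincomb _ _ (raddfD f)) vE gK.
Qed.

Definition gen_tuples (A : finZmodType) n : {set {ffun 'I_n -> A}} :=
  [set e | generating e]%SET.

(** Automorphisms act freely on generating tuples, and by [gram_iso] their orbits are the fibres of
    the Gram map. *)
Lemma card_gen_tuples_Aut (A : finZmodType) (kA : killed M.+1 A)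
    (d : A -> A -> QmodZ) (dd : duality_pairing d) n :
  #|gen_tuples A n| =
    (#|[set gram d e | e in gen_tuples A n]%SET| * #|pairing_Aut d|)%N.
Proof.
apply: card_fibers => e; rewrite inE => ge.
pose h (a : {perm A}) : {ffun 'I_n -> A} := [ffun i => a (e i)].
rewrite -(@card_in_imset _ _ h); last first.
  move=> a b /pairing_AutP[am _] /pairing_AutP[bm _] hab; apply/permP => x.
  have /generatingP/(_ x)[v <-] := ge.
  by rewrite (additive_lincomb e v am) (additive_lincomb e v bm) -/(h a) hab.
apply: eq_card => e'; rewrite !inE; apply/andP/imsetP => [[ge' /eqP ee']|].
  have [f [bf fd fe]] := gram_iso kA kA dd dd ge ge' (esym ee').
  exists (perm (bij_inj bf)); last by apply/ffunP => i; rewrite ffunE permE fe.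
  by apply/pairing_AutP; split=> x y; rewrite !permE ?raddfD ?fd.
move=> [a /pairing_AutP[am ad] ->]; split; last by rewrite (gram_morph e ad).
apply/generatingP => x; have /generatingP/(_ ((a^-1)%g x))[v vE] := ge.
by exists v; rewrite -additive_lincomb// vE permKV.
Qed.

(** * Realising every symmetric matrix as a Gram matrix *)

Section ImageGroup.
Variables (n : nat) (S : 'M[R]_n).

Definition row_image : pred 'rV[R]_n := fun x => [exists v, v *m S == x].

Let row_image_zmod : zmod_closed row_image.
Proof.
split=> [|x y /existsP[v /eqP vx] /existsP[w /eqP wy]]; apply/existsP.
  by exists 0; rewrite mul0mx.
by exists (v - w); rewrite mulmxBl vx wy.
Qed.

HB.instance Definition _ := GRing.isZmodClosed.Build _ row_image row_image_zmod.

Definition row_imageT := {x : 'rV[R]_n | row_image x}.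

HB.instance Definition _ := Finite.on row_imageT.
HB.instance Definition _ := SubType.on row_imageT.
HB.instance Definition _ := [SubChoice_isSubZmodule of row_imageT by <:].

End ImageGroup.

(** The group is the row space of [S], with [d (v S, w S) = v S w^T / N] and the rows of [S] as
    generators. *)
Lemma gram_surj n (S : 'M[R]_n) : S^T = S -> exists (A : dualPGroup p),
  killed M.+1 A /\ exists2 e : {ffun 'I_n -> A}, generating e & gram (delta A) e = S.
Proof.
move=> sS; pose T : finZmodType := row_imageT S.
have exT (x : T) : exists v, v *m S == val x by have /existsP := valP x.
pose pre (x : T) := xchoose (exT x).
have preS x : pre x *m S = val x by apply/eqP; exact: (xchooseP (exT x)).
pose d (x y : T) := to_QmodZ ((pre x *m (val y)^T) 0 0).
have dE x y : d x y = to_QmodZ ((pre x *m S *m (pre y)^T) 0 0).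
  by rewrite /d -preS trmx_mul sS mulmxA.
(* Symmetry of [S] makes the pairing independent of the preimage chosen by [pre]. *)
have dvE (x y : T) v : v *m S = val x -> d x y = to_QmodZ ((v *m (val y)^T) 0 0).
  move=> vx; rewrite dE -(preS y) trmx_mul sS mulmxA; congr (to_QmodZ (_ 0 0)).
  by rewrite preS -vx.
have dsym x y : d x y = d y x.
  have tr11 (X : 'M[R]_1) : X^T = X by apply/matrixP => i j; rewrite mxE !ord1.
  rewrite !dE -[pre x *m S *m _]tr11.
  by rewrite !trmx_mul trmxK sS mulmxA.
have dDl x y z : d (x + y) z = d x z + d y z.
  rewrite (@dvE (x + y) z (pre x + pre y)); last by rewrite mulmxDl !preS raddfD.
  by rewrite mulmxDl mxE raddfD.
have rP v : row_image S (v *m S) by apply/existsP; exists v.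
pose r v : T := exist _ (v *m S) (rP v).
have kT : killed M.+1 T.
  by move=> x; apply: val_inj; rewrite raddfMn raddf0; exact: Zpk_torsion.
pose e : {ffun 'I_n -> T} := [ffun i => r (delta_mx 0 i)].
have eE v : lincomb e v = r v.
  apply: val_inj; rewrite (additive_lincomb e v (raddfD val)) /= mulmx_sum_row.
  apply: eq_bigr => i _.
  by rewrite !ffunE /= -rowE -scaler_nat -Zpk_natE.
have dd : duality_pairing d.
  split=> //.
  - by move=> x y z; rewrite dsym dDl !(dsym _ x).
  - move=> x x' xx'; apply: val_inj; apply/rowP => j.
    apply: to_QmodZ_inj; have := xx' (r (delta_mx 0 j)).
    rewrite !(dsym _ (r _)) !(@dvE (r _) _ (delta_mx 0 j))//.
    by rewrite -!rowE !mxE.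
  - move=> f.
    pose c : 'rV[R]_n := \row_i of_QmodZ (f (e i)).
    have fr v : f (r v) = to_QmodZ ((c *m v^T) 0 0).
      rewrite -eE raddf_sum mxE raddf_sum; apply: eq_bigr => i _ /=.
      rewrite raddfMn [v^T i 0]mxE to_QmodZM [c 0 i]mxE of_QmodZK//.
      by rewrite -raddfMn kT raddf0.
    (* The values of the character [f] on the generators form a row [c] that pairs to zero with the
       radical of [S]. The double annihilator property then yields the element representing [f]. *)
    have [w wE] : exists w, c = w *m S.
      apply: mul_annihilator => // v vS; apply/rowP => i; rewrite ord1 [RHS]mxE.
      apply: to_QmodZ_inj; rewrite -fr raddf0.
      suff -> : r v = 0 by rewrite raddf0.
      by apply: val_inj; rewrite raddf0 /= vS.
    exists (r w) => x; have -> : x = r (pre x) by apply: val_inj; rewrite /= preS.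
    by rewrite fr wE (@dvE (r w) _ w)//= trmx_mul sS mulmxA.
have ge : generating e.
  by apply/generatingP => x; exists (pre x); rewrite eE; apply: val_inj; rewrite /= preS.
have gS : gram d e = S.
  apply/matrixP => i j; rewrite mxE !ffunE (@dvE (r _) _ (delta_mx 0 i))//=.
  rewrite trmx_mul trmx_delta sS -[S *m _]colE -rowE !mxE.
  exact: to_QmodZK.
have pT : (p.-group [set: T])%g.
  rewrite /pgroup cardsT (card_gram kT dd ge) gS.
  have : (form_size S %| p ^ (M.+1 * n))%N.
    by rewrite expnM -(form_size_radical S) dvdn_mulr.
  by move=> /(dvdn_pfactor _ _ p_prime)[k _ ->]; rewrite pnatX pnat_id.
have [A [f [bf fd]]] := dual_of_iso pT dd.
exists A; split.
  by move=> x; have [g fK gK] := bf; rewrite -[x]gK -raddfMn kT raddf0.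
exists [ffun i => f (e i)]; first exact: generating_morph.
by rewrite (gram_morph e fd).
Qed.

(** * Counting the generating tuples of a group *)

Definition sigma n r : nat := (\prod_(i < r) (p ^ n - p ^ i))%N.

Lemma card_row_full n r :
  #|[set A : 'M['F_p]_(n, r) | row_full A]%SET| = sigma n r.
Proof.
have cF : #|'F_p| = p by exact: card_Fp.
transitivity #|[set A : 'M['F_p]_(r, n) | row_free A]%SET|.
  rewrite -(card_imset (mem [set A : 'M['F_p]_(r, n) | row_free A]%SET)
    (can_inj (@trmxK _ r n))).
  apply: eq_card => A; rewrite inE; apply/idP/imsetP => [fA|[B]].
    by exists A^T; rewrite ?trmxK// inE /row_free mxrank_tr.
  by rewrite inE => fB ->; rewrite /row_full mxrank_tr.
by rewrite card_row_free; apply: eq_bigr => i _; rewrite cF.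
Qed.

(** In a tuple of least length no relation has a unit coefficient, since the corresponding generator
    could be dropped; hence all relations are divisible by [p]. *)
Lemma minimal_generators (A : finZmodType) : killed M.+1 A ->
  exists (r : nat) (f : {ffun 'I_r -> A}), generating f /\
    forall v, lincomb f v = 0 -> v *+ p ^ M = 0.
Proof.
move=> kA; pose P r := [exists f : {ffun 'I_r -> A}, generating f].
have exP : exists r, P r.
  exists #|A|; apply/existsP; exists [ffun i => enum_val i]; apply/generatingP => x.
  exists (delta_mx 0 (enum_rank x)); rewrite lincomb_delta// ffunE enum_rankK//.
case: (ex_minnP exP) => r /existsP[f gf] rmin; exists r, f; split=> // v v0.
apply/eqP; rewrite -red_mx_eq0; apply: contraT => /matrix0Pn[i0 [i]].
rewrite mxE ord1 => /red_unit uv.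
case: r => [|r] in f gf rmin v v0 i uv *; first by case: i uv.
suff /rmin : P r by rewrite ltnn.
apply/existsP; exists [ffun j => f (lift i j)]; apply/generatingP => x.
have /generatingP/(_ x)[w wE] := gf.
(* Subtracting a multiple of the relation [v] clears the coefficient of generator [i]. *)
pose w' := w - (w 0 i / v 0 i) *: v.
have w'i : w' 0 i = 0 by rewrite !mxE divrK ?subrr.
exists (\row_j w' 0 (lift i j)).
rewrite -wE; transitivity (lincomb f w'); last first.
  by rewrite lincomb_zmod// lincombZ// v0 mul0rn subr0.
rewrite /lincomb (bigD1_ord i)//= w'i add0r.
by apply: eq_bigr => j _; rewrite ffunE mxE.
Qed.

(** Tuples are written as matrices [C] over a minimal generating tuple, and generate exactly when
    [C] has full rank modulo [p]. Full-rank matrices, and then all matrices, are counted both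
    through [phi] and through reduction modulo [p]; the kernel orders [k] and [q] cancel. *)
Lemma card_gen_tuples (A : finZmodType) (kA : killed M.+1 A)
    (d : A -> A -> QmodZ) (dd : duality_pairing d) n :
  (#|gen_tuples A n| * p ^ (n * prank p A))%N = (sigma n (prank p A) * #|A| ^ n)%N.
Proof.
have [r [f [gf fM]]] := minimal_generators kA.
have -> : prank p A = r.
  rewrite (prank_gram kA dd gf); apply/eqP; rewrite -full_form_rank.
  apply/full_formP => v /eqP; rewrite -(lincomb_eq0 kA dd)// => /eqP; exact: fM.
pose phi (C : 'M[R]_(n, r)) : {ffun 'I_n -> A} := [ffun i => lincomb f (row i C)].
have phiP C : generating (phi C) = row_full (map_mx red C).
  apply/generatingP/row_fullP => [gC|[D' D'E] x].
    have ex i : exists u, lincomb (phi C) u == f i.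
      by have [u <-] := gC (f i); exists u.
    (* Rewriting each [f i] through the tuple [phi C] gives a relation between the [f i], which
       vanishes modulo [p] by minimality. *)
    exists (map_mx red (\matrix_i xchoose (ex i))); apply/row_matrixP => i.
    rewrite -map_mxM; apply/eqP; rewrite -subr_eq0.
    rewrite -(map_mx1 red) -!map_row -map_mxB red_mx_eq0 row_mul rowK row1.
    apply/eqP/fM; rewrite lincomb_zmod// -lincomb_mul// lincomb_delta//.
    by apply/eqP; rewrite subr_eq0 (xchooseP (ex i)).
  pose D := map_mx lift_Fp D'.
  have uDC : D *m C \in unitmx by apply: red_unitmx; rewrite map_mxM lift_mxK D'E unitmx1.
  have /generatingP/(_ x)[w <-] := gf; exists (w *m invmx (D *m C) *m D).
  by rewrite lincomb_mul// -!mulmxA mulVmx// mulmx1.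
pose k := #|[set C : 'M[R]_(n, r) | phi C == [ffun=> 0]]%SET|.
pose q := #|[set C : 'M[R]_(n, r) | map_mx red C == 0]%SET|.
have phiB C C' : (phi C == phi C') = (phi (C - C') == [ffun=> 0]).
  apply/eqP/eqP => /ffunP h; apply/ffunP => i; have := h i; rewrite !ffunE.
    by rewrite linearB lincomb_zmod// => ->; rewrite subrr.
  by rewrite linearB lincomb_zmod// => /eqP; rewrite subr_eq0 => /eqP.
have fib (T : finType) (g : 'M[R]_(n, r) -> T) z (D : {set 'M[R]_(n, r)}) :
    (forall C C', (g C == g C') = (g (C - C') == z)) ->
    (forall C C', C \in D -> g C' == g C -> C' \in D) ->
    #|D| = (#|[set g C | C in D]%SET| * #|[set C | g C == z]%SET|)%N.
  move=> gB gD; apply: card_fibers => C DC.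
  rewrite -(card_imset (mem [set C | g C == z]%SET) (addrI C)).
  apply: eq_card => C'; rewrite inE; apply/andP/imsetP => [[_ gC]|[X + ->]].
    by exists (C' - C); rewrite ?inE -?gB// addrCA subrr addr0.
  rewrite inE => gX; have gCX : g (C + X) == g C by rewrite gB addrAC subrr add0r.
  by split=> //; exact: gD gCX.
pose D := [set C : 'M[R]_(n, r) | row_full (map_mx red C)]%SET.
have D1 : #|D| = (#|gen_tuples A n| * k)%N.
  rewrite (fib _ phi _ D phiB) => [|C C']; last first.
    by rewrite !inE -!phiP => gC /eqP ->.
  congr (_ * _)%N; apply: eq_card => e; rewrite inE; apply/imsetP/idP => [[C + ->]|ge].
    by rewrite inE phiP.
  have ex i : exists v, lincomb f v == e i.
    by have /generatingP/(_ (e i))[v <-] := gf; exists v.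
  have eE : e = phi (\matrix_i xchoose (ex i)).
    by apply/ffunP => i; rewrite ffunE rowK (eqP (xchooseP (ex i))).
  by exists (\matrix_i xchoose (ex i)); rewrite // inE -phiP -eE.
have redB (C C' : 'M[R]_(n, r)) : (map_mx red C == map_mx red C') = (map_mx red (C - C') == 0).
  by rewrite map_mxB subr_eq0.
have D2 : #|D| = (sigma n r * q)%N.
  rewrite (fib _ (map_mx red) _ D redB) => [|C C']; last first.
    by rewrite !inE => fC /eqP ->.
  congr (_ * _)%N; rewrite -card_row_full; apply: eq_card => C'; rewrite inE.
  apply/imsetP/idP => [[C + ->]|fC]; first by rewrite inE.
  by exists (map_mx lift_Fp C'); rewrite ?inE lift_mxK.
have T1 : (N ^ (n * r))%N = (#|A| ^ n * k)%N.
  rewrite -card_Zpk -card_mx -cardsT (fib _ phi _ _ phiB)//.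
  have -> : (#|A| ^ n)%N = #|{: {ffun 'I_n -> A}}| by rewrite card_ffun card_ord.
  congr (_ * _)%N; rewrite -cardsT; apply: eq_card => e.
  rewrite [RHS]inE; apply/imsetP.
  have ex i : exists v, lincomb f v == e i.
    by have /generatingP/(_ (e i))[v <-] := gf; exists v.
  exists (\matrix_i xchoose (ex i)) => //.
  by apply/ffunP => i; rewrite ffunE rowK (eqP (xchooseP (ex i))).
have T2 : (N ^ (n * r))%N = (p ^ (n * r) * q)%N.
  rewrite -card_Zpk -card_mx -cardsT (fib _ (map_mx red) _ _ redB)//.
  have -> : (p ^ (n * r))%N = #|{: 'M['F_p]_(n, r)}| by rewrite card_mx card_Fp.
  congr (_ * _)%N; rewrite -cardsT; apply: eq_card => C; rewrite [RHS]inE; apply/imsetP.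
  by exists (map_mx lift_Fp C); rewrite ?lift_mxK.
have kq : (0 < k * q)%N.
  rewrite muln_gt0; apply/andP; split; apply/card_gt0P; exists 0; rewrite inE.
    by apply/eqP/ffunP => i; rewrite !ffunE row0 -[RHS](raddf0 (lincomb_additive kA f)).
  by rewrite map_mx0.
apply/eqP; rewrite -(eqn_pmul2r kq); apply/eqP.
rewrite mulnACA -D1 -T2 D2 T1.
by rewrite mulnACA [(q * k)%N]mulnC.
Qed.

(** * Weighted counts of symmetric matrices *)

Section Weights.
Variable K : realType.
Implicit Types (n m s : nat).

Let pK_neq0 : p%:R != 0 :> K.
Proof. by rewrite pnatr_eq0 -lt0n. Qed.

(** A class accounts for a number of matrices proportional, at fixed [n] and rank, to
    [#A ^ n / #Aut]. The exponent [n.+1] thus leaves the mass [1 / (#A * #Aut)]. *)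
Definition weight n m s : K :=
  \sum_(S : 'M[R]_n | [&& S^T == S, S *+ p ^ m == 0 & form_rank S == s])
    (form_size S)%:R ^- n.+1.

Let rank_partition n (P : pred 'M[R]_n) (F : 'M[R]_n -> K) :
  \sum_(S | P S) F S = \sum_(s < n.+1) \sum_(S | P S && (form_rank S == s)) F S.
Proof.
rewrite (partition_big (fun S => inord (form_rank S) : 'I_n.+1) predT)//=.
apply: eq_bigr => s _; apply: eq_bigl => S; congr (_ && _).
by rewrite -val_eqE /= inordK// ltnS form_rank_leq.
Qed.

(** The full-rank matrices [X] are grouped by [S = p X]. Each [S] has the number of lifts given by
    [card_full_lifts], and each lift has size [p ^ n] times that of [S], whence the factor
    [p ^ (n * n.+1)]. *)
Lemma weight_rec n m : (m <= M)%N ->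
  weight n m.+1 n = \sum_(s < n.+1)
    (full_count (n - s))%:R * p%:R ^+ 'C(n.+1, 2) / p%:R ^+ 'C((n - s).+1, 2)
      / p%:R ^+ (n * n.+1) * weight n m s.
Proof.
move=> mM; pose Q (S : 'M[R]_n) := (S^T == S) && (S *+ p ^ m == 0).
rewrite /weight (partition_big (fun S => S *+ p) Q) /=; last first.
  move=> S /and3P[/eqP sS /eqP S0 _]; rewrite /Q linearMn /= sS eqxx /=.
  by rewrite -mulrnA -(expnS p m) S0.
rewrite rank_partition; apply: eq_bigr => s _; rewrite big_distrr /=.
apply: eq_big => [S|S /andP[/andP[/eqP sS /eqP Sm] /eqP rS]].
  by rewrite /Q -andbA.
have S0 : S *+ p ^ M = 0.
  have -> : (p ^ M = p ^ m * p ^ (M - m))%N by rewrite -expnD subnKC.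
  by rewrite mulrnA Sm mul0rn.
have := card_full_lifts sS S0; rewrite rS => /(congr1 (fun x => x%:R : K)).
rewrite !natrM !natrX => cE.
transitivity (\sum_(X in [set X : 'M[R]_n | [&& X^T == X, X *+ p == S & full_form X]]%SET)
    ((form_size S)%:R * p%:R ^+ n : K) ^- n.+1).
  apply: eq_big => [X|X].
    rewrite inE full_form_rank; case: (X^T == X) => //=.
    case: (X *+ p =P S) => [XS|]; rewrite ?andbF// andbT.
    by rewrite (expnS p m) mulrnA XS Sm eqxx.
  move=> /andP[/and3P[_ _ /eqP rX] /eqP XS].
  by rewrite (form_sizeE X) rX XS natrM natrX.
rewrite sumr_const -[LHS]mulr_natl; set L := #|_|%:R in cE *.
have -> : L = (full_count (n - s))%:R * p%:R ^+ 'C(n.+1, 2) / p%:R ^+ 'C((n - s).+1, 2).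
  by rewrite -cE mulfK// expf_neq0.
by rewrite exprMn invfM -exprM mulrCA mulrC -!mulrA.
Qed.

Let form_size_torsion n (S : 'M[R]_n) : S *+ p = 0 ->
  form_size S = (p ^ form_rank S)%N.
Proof.
move=> S0; rewrite form_sizeE S0 (_ : form_size 0 = 1%N) ?mul1n//.
rewrite /form_size (_ : [set _ | _ in _]%SET = [set 0]%SET) ?cards1//.
apply/setP => x; rewrite inE; apply/imsetP/eqP => [[v _ ->]|->].
  by rewrite mulmx0.
by exists 0; rewrite ?mul0mx.
Qed.

Lemma weight_full_count n :
  weight n 1 n = (full_count n)%:R / p%:R ^+ (n * n.+1).
Proof.
rewrite /weight (eq_bigl (fun S => S \in [set X in sym_torsion n | full_form X]%SET)).
  rewrite (eq_bigr (fun=> (p%:R ^+ (n * n.+1))^-1)).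
    by rewrite sumr_const mulr_natl.
  move=> S; rewrite !inE full_form_rank => /andP[/andP[_ /eqP S0] /eqP rS].
  by rewrite form_size_torsion// rS natrX -exprM.
by move=> S; rewrite !inE full_form_rank expn1 andbA.
Qed.

(** All symmetric matrices over [F_p] are counted by rank; on rank [s] the size is [p ^ s], and the
    prefactor undoes the weight. *)
Lemma weight_total n :
  \sum_(s < n.+1) p%:R ^+ (s * n.+1) * weight n 1 s = p%:R ^+ 'C(n.+1, 2).
Proof.
rewrite -natrX -card_sym_torsion -sum1_card natr_sum rank_partition.
apply: eq_bigr => s _; rewrite big_distrr /=; apply: eq_big => S.
  by rewrite inE expn1 andbA.
move=> /and3P[_ /eqP]; rewrite expn1 => S0 /eqP rS.
by rewrite form_size_torsion// rS natrX -exprM mulfV// expf_neq0.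
Qed.

End Weights.

(** * From weighted matrices to the measure of isomorphism classes *)

Lemma killed_iso (A B : finZmodType) (dA : A -> A -> QmodZ) (dB : B -> B -> QmodZ) m :
  pairing_iso dA dB -> killed m A -> killed m B.
Proof.
move=> [f [[g fK gK] _]] kA y.
by rewrite -[y]gK -raddfMn kA raddf0.
Qed.

Definition rank_class (s m : nat) : set (isoClass p) :=
  [set c | class_prank c = s /\ killed m (generic_quotient.repr c)]%classic.

Lemma sigma_gt0 n s : (s <= n)%N -> (0 < sigma n s)%N.
Proof.
move=> sn; rewrite prodn_gt0// => i; rewrite subn_gt0 ltn_exp2l ?prime_gt1//.
exact: leq_trans (ltn_ord i) sn.
Qed.

Lemma repr_iso (A : dualPGroup p) :
  pairing_iso (delta A) (delta (generic_quotient.repr (\pi_(isoClass p)%qT A))).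
Proof. by apply/isoClass_eqP; rewrite reprK. Qed.

(** Each matrix determines a class, and the matrices above a class are the Gram matrices of its
    generating tuples. Their number comes from equating the two counts of generating tuples. *)
Lemma mu_rank_class (K : realType) n m s : (m <= M.+1)%N -> (s <= n)%N ->
  (mu K (rank_class s m) * ((sigma n s)%:R / p%:R ^+ (n * s))%:E =
   (mu_product K p * weight K n m s)%:E)%E.
Proof.
move=> mM sn.
have kM (A : finZmodType) : killed m A -> killed M.+1 A.
  by move=> kA x; rewrite -(subnKC mM) expnD mulrnA kA mul0rn.
(* [kap S] is the class presented by [S]; its value at a nonsymmetric matrix is arbitrary. *)
have /choice[kap kapP] : forall S : 'M[R]_n, exists c : isoClass p, S^T = S ->
    killed M.+1 (generic_quotient.repr c) /\
    exists2 e : {ffun 'I_n -> generic_quotient.repr c}, generating e &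
      gram (delta (generic_quotient.repr c)) e = S.
  move=> S; have [sS|nS] := pselect (S^T = S); last by exists point.
  have [A [kA [e ge eS]]] := gram_surj sS.
  have [f [bf fd]] := repr_iso A.
  exists (\pi_(isoClass p)%qT A) => _; split; first exact: (killed_iso (repr_iso A)).
  exists [ffun i => f (e i)]; first exact: generating_morph.
  by rewrite (gram_morph e fd).
pose P (S : 'M[R]_n) := [&& S^T == S, S *+ p ^ m == 0 & form_rank S == s].
have kapE (S : 'M[R]_n) (c : isoClass p) : S^T = S ->
    killed M.+1 (generic_quotient.repr c) ->
    (kap S == c) = (S \in [set gram (delta (generic_quotient.repr c)) e
                          | e in gen_tuples (generic_quotient.repr c) n]%SET).
  move=> sS kc; have [kS [e ge eS]] := kapP S sS.
  apply/eqP/imsetP => [Sc|[e' ]].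
    by rewrite -Sc; exists e; rewrite ?inE.
  rewrite inE => ge' e'S.
  have [f [bf fd _]] := gram_iso kS kc (dp_duality _) (dp_duality _) ge ge' (etrans eS e'S).
  by rewrite -[kap S]reprK -[c]reprK; apply/isoClass_eqP; exists f.
have kapP' S : P S -> [/\ rank_class s m (kap S),
    #|generic_quotient.repr (kap S)| = form_size S & S^T = S].
  move=> /and3P[/eqP sS /eqP S0 /eqP rS]; have [kS [e ge eS]] := kapP S sS.
  split=> //.
    split; first by rewrite /class_prank (prank_gram kS (dp_duality _) ge) eS.
    by apply/(killed_gram kS (dp_duality _) m ge); rewrite eS.
  by rewrite (card_gram kS (dp_duality _) ge) eS.
have gramP (c : isoClass p) (e : {ffun 'I_n -> generic_quotient.repr c}) :
    rank_class s m c -> generating e -> P (gram (delta (generic_quotient.repr c)) e).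
  move=> [rc kc] ge; rewrite /P (gram_sym (dp_duality _)) eqxx /=.
  rewrite -(prank_gram (kM _ kc) (dp_duality _) ge) [prank _ _]rc eqxx andbT.
  by apply/eqP/(killed_gram (kM _ kc) (dp_duality _) m ge).
(* [u] lists the whole rank class, which is therefore finite: as [s <= n], every class in it has a
   generating [n]-tuple and so a Gram matrix. *)
pose u := undup [seq kap X | X <- enum P].
have uE : rank_class s m = [set` u]%classic.
  apply/seteqP; split=> [c Xc|c] /=; rewrite mem_undup; last first.
    by move=> /mapP[S]; rewrite mem_enum => /kapP'[Xc _ _] ->.
  have [rc kc] := Xc.
  have : (0 < #|gen_tuples (generic_quotient.repr c) n|)%N.
    rewrite lt0n; apply/eqP => g0.
    have := card_gen_tuples (kM _ kc) (dp_duality (generic_quotient.repr c)) n.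
    rewrite g0 mul0n => /esym/eqP; rewrite muln_eq0 expn_eq0 => /orP[|/andP[+ _]].
      by rewrite [prank _ _]rc gtn_eqF// sigma_gt0.
    by rewrite gtn_eqF//; apply/card_gt0P; exists 0.
  move=> /card_gt0P[e]; rewrite inE => ge.
  set S := gram (delta (generic_quotient.repr c)) e.
  have PS : P S by exact: gramP.
  apply/mapP; exists S; first by rewrite mem_enum.
  apply/esym/eqP; rewrite kapE; first by apply/imsetP; exists e; rewrite ?inE.
    by have [] := kapP' S PS.
  exact: kM.
have muE : mu K (rank_class s m) = (\sum_(c <- u) class_mass K c)%:E.
  rewrite /mu uE esum_fset; first by rewrite -fsbig_seq ?undup_uniq// sumEFin.
    exact: finite_seq.
  by move=> c _; rewrite lee_fin mass_ge0.
rewrite muE -EFinM; congr (_%:E); rewrite mulr_suml /weight mulr_sumr.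
transitivity (\sum_(c <- u) \sum_(S | P S && (kap S == c))
    mu_product K p * (form_size S)%:R ^- n.+1); last first.
  rewrite (exchange_big_dep P)/= => [|c S _ /andP[]//].
  apply: eq_bigr => S PS; rewrite PS /= (eq_bigl (pred1 (kap S))); last first.
    by move=> c; rewrite /= eq_sym.
  rewrite -big_filter filter_pred1_uniq ?undup_uniq ?big_seq1//.
  by rewrite mem_undup; apply: map_f; rewrite mem_enum.
rewrite !big_seq; apply: eq_bigr => c cu.
have Xc : rank_class s m c by rewrite uE.
have [rc kc] := Xc.
set A := generic_quotient.repr c in rc kc *.
rewrite (eq_bigr (fun=> mu_product K p * #|A|%:R ^- n.+1)); last first.
  by move=> S /andP[/kapP'[_ + _] /eqP kS]; rewrite kS => ->.
rewrite (eq_bigl (fun S => S \in [set gram (delta A) e | e in gen_tuples A n]%SET));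
  last first.
  move=> S; apply/andP/idP => [[/kapP'[_ _ sS]]|]; first by rewrite kapE//; exact: kM.
  move=> SA; have /imsetP[e + Se] := SA; rewrite inE => ge.
  have PS : P S by rewrite Se; exact: gramP.
  by split=> //; rewrite kapE//; [have [] := kapP' S PS | exact: kM].
rewrite sumr_const /class_mass /mass -/A.
have := card_gen_tuples (kM _ kc) (dp_duality A) n.
rewrite [prank _ _]rc (card_gen_tuples_Aut (kM _ kc) (dp_duality A)).
set g := #|[set _ | _ in _]%SET|; set a := #|pairing_Aut _|.
move=> /(congr1 (fun x => x%:R : K)); rewrite !natrM !natrX => gE.
have A0 : #|A|%:R != 0 :> K by rewrite pnatr_eq0 -lt0n; apply/card_gt0P; exists 0.
have a0 : a%:R != 0 :> K by rewrite pnatr_eq0 -lt0n cardG_gt0.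
have p0 : p%:R ^+ (n * s) != 0 :> K by rewrite expf_neq0// pnatr_eq0 -lt0n.
rewrite -[RHS]mulr_natl.
have gE' : g%:R = (sigma n s)%:R * #|A|%:R ^+ n / (a%:R * p%:R ^+ (n * s)) :> K.
  by apply: (mulIf (mulf_neq0 a0 p0)); rewrite divfK ?mulf_neq0// mulrA; exact: gE.
rewrite gE' exprS !invfM.
have Anz : #|A|%:R ^+ n != 0 :> K by rewrite expf_neq0.
rewrite -!mulrA !(mulrCA (#|A|%:R ^+ n)) mulfV// mulr1.
rewrite !(mulrCA _ (mu_product K p)); congr (_ * _).
by rewrite mulrC -!mulrA mulrCA.
Qed.

End Zpk.

(** * Euler's identity *)

Section Euler.
Variables (K : realType) (p : nat).
Hypothesis p_prime : prime p.

Let t : K := p%:R^-1.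

Let p_gt0 : (0 : K) < p%:R.
Proof. by rewrite ltr0n prime_gt0. Qed.

Let pt : p%:R * t = 1 :> K.
Proof. by rewrite mulfV// gt_eqF. Qed.

Let t_gt0 : 0 < t.
Proof. by rewrite invr_gt0. Qed.

Let t_le : 2 * t <= 1.
Proof. by rewrite -[leRHS]pt ler_pM2r// ler_nat prime_gt1. Qed.

(** The order of [GL_r(F_p)] divided by [p ^ 'C(r, 2)]. *)
Definition qfact (r : nat) : K := \prod_(i < r) (p%:R ^+ i.+1 - 1).

Lemma qfactS r : qfact r.+1 = qfact r * (p%:R ^+ r.+1 - 1).
Proof. by rewrite /qfact big_ord_recr. Qed.

Lemma qfact0 : qfact 0 = 1.
Proof. by rewrite /qfact big_ord0. Qed.

Lemma pexp_ge2 r : 2 <= p%:R ^+ r.+1 :> K.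
Proof.
rewrite exprS -[2]mulr1 ler_pM// ?ler_nat ?prime_gt1//.
by rewrite exprn_ege1// ler1n prime_gt0.
Qed.

Lemma qfact_gt0 r : 0 < qfact r.
Proof. by apply: prodr_gt0 => i _; have := pexp_ge2 i; lra. Qed.

(** The factor 2 on the right accommodates [p = 2], where [qfact 1 = 1]. *)
Let qfact_ge r : 2 ^+ r <= 2 * qfact r.
Proof.
elim: r => [|[|r] IHr]; first by rewrite qfact0 expr0; lra.
  by rewrite qfactS qfact0 !expr1; have := pexp_ge2 0; rewrite expr1; lra.
rewrite qfactS exprS mulrA mulrC ler_pM// ?exprn_ge0//.
have : 2 * 2 <= p%:R ^+ r.+2 :> K.
  by rewrite exprS; apply: ler_pM => //; [rewrite ler_nat prime_gt1|exact: pexp_ge2].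
by lra.
Qed.

Definition qseries (y : K) : \bar K := (\sum_(0 <= r <oo) (y ^+ r / qfact r)%:E)%E.

Let term_ge0 (y : K) r : 0 <= y -> (0 <= (y ^+ r / qfact r)%:E)%E.
Proof. by move=> y0; rewrite lee_fin divr_ge0 ?exprn_ge0// ltW// qfact_gt0. Qed.

Let nneseries_shift (f : nat -> \bar K) : (forall k, 0 <= f k)%E ->
  (\sum_(1 <= k <oo) f k = \sum_(0 <= k <oo) f k.+1)%E.
Proof.
by move=> f0; rewrite -nneseries_addn//; apply: eq_eseriesr => i _; rewrite addn1.
Qed.

(** Writing [p ^ r = 1 + (p ^ r - 1)] splits the series. In the second part [p ^ r - 1] cancels the
    last factor of [qfact r], which leaves [y] times the shifted series. *)
Lemma qseries_mulp (y : K) : 0 <= y ->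
  (qseries (p%:R * y) = (1 + y)%:E * qseries y)%E.
Proof.
move=> y0; rewrite /qseries.
have d0 k : (0 <= (y ^+ k * (p%:R ^+ k - 1) / qfact k)%:E :> \bar K)%E.
  rewrite lee_fin divr_ge0 ?mulr_ge0 ?exprn_ge0// ?(ltW (qfact_gt0 _))//.
  by rewrite subr_ge0 exprn_ege1// ler1n prime_gt0.
under eq_eseriesr => r _.
  rewrite exprMn (_ : (_ / _)%:E = (y ^+ r / qfact r)%:E +
    (y ^+ r * (p%:R ^+ r - 1) / qfact r)%:E)%E; last first.
    by rewrite -EFinD -mulrDl; congr (_ / _)%:E; lra.
  over.
rewrite nneseriesD//; last by move=> i _ _; exact: term_ge0.
rewrite EFinD ge0_muleDl ?lee_fin//.
rewrite mul1e; congr (_ + _)%E.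
rewrite nneseries_recl// expr0 subrr mulr0 mul0r add0e nneseries_shift//.
rewrite -nneseriesZl; last by move=> i _; exact: term_ge0.
apply: eq_eseriesr => r _; rewrite -EFinM qfactS exprS; congr _%:E.
have := pexp_ge2 r => h; have h' : p%:R ^+ r.+1 - 1 != 0 :> K by lra.
by rewrite -mulf_div mulfV// mulr1 mulrA.
Qed.

Lemma qseries_mulpX (k : nat) :
  (qseries (p%:R ^+ k) = (\prod_(0 <= j < k) (p%:R ^+ j + 1))%:E * qseries 1)%E.
Proof.
elim: k => [|k IHk]; first by rewrite big_nil mul1e.
rewrite exprS qseries_mulp ?exprn_ge0// IHk muleA -EFinM big_nat_recr//=.
by rewrite mulrC [1 + _]addrC.
Qed.

Let qseries1_fin : qseries 1 \is a fin_num.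
Proof.
rewrite ge0_fin_numE; last by apply: nneseries_ge0 => r _ _; exact: term_ge0.
apply: (@le_lt_trans _ _ (\sum_(0 <= r <oo) (geometric 2 2^-1 r)%:E)%E).
  apply: lee_nneseries => [r _ _|r _]; first exact: term_ge0.
  rewrite lee_fin /geometric /= expr1n div1r exprVn.
  rewrite ler_pdivlMr ?exprn_gt0// mulrC ler_pdivrMr ?qfact_gt0//.
have cg : cvgn (series (geometric (2 : K) 2^-1)).
  by apply: is_cvg_geometric_series; rewrite ger0_norm ?invr_ge0//; lra.
rewrite (_ : (\sum_(0 <= r <oo) _)%E = (limn (series (geometric (2 : K) 2^-1)))%:E) ?ltry//.
rewrite -EFin_lim//; congr (limn _); apply/funext => n /=.
by rewrite /series /= sumEFin.
Qed.

Let e1 : K := fine (qseries 1).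

Let qseries1E : qseries 1 = e1%:E.
Proof. by rewrite fineK. Qed.

Let P (n : nat) : K := \prod_(i < n) (1 + t ^+ i.+1).

Let qseries_P n : (qseries 1 = (P n)%:E * qseries (t ^+ n))%E.
Proof.
elim: n => [|n IHn]; first by rewrite /P big_ord0 mul1e.
rewrite IHn /P big_ord_recr /= EFinM -muleA; congr (_ * _)%E.
rewrite -qseries_mulp ?exprn_ge0 ?(ltW t_gt0)//.
by rewrite exprS mulrA pt mul1r.
Qed.

(** After the constant term 1, each [y ^ r] is at most [y]. Applied to [y = t ^ n], this makes
    [qseries (t ^ n)] tend to 1. *)
Let qseries_bound (y : K) : 0 <= y -> y <= 1 ->
  (1%:E <= qseries y <= (1 + y * e1)%:E)%E.
Proof.
move=> y0 y1; rewrite {1 2}/qseries !nneseries_recl//; try by move=> k _; exact: term_ge0.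
rewrite expr0 qfact0 divr1; apply/andP; split.
  by rewrite leeDl// nneseries_ge0// => k _ _; exact: term_ge0.
rewrite EFinD leeD2l// EFinM -qseries1E /qseries -nneseriesZl; last first.
  by move=> i _; exact: term_ge0.
rewrite [leRHS]nneseries_recl//; last first.
  by move=> k _; rewrite mule_ge0 ?lee_fin// ltW// divr_gt0 ?exprn_gt0 ?qfact_gt0.
rewrite -[leLHS]add0e leeD//.
  by rewrite mule_ge0 ?lee_fin// ltW// divr_gt0 ?exprn_gt0 ?qfact_gt0.
rewrite !nneseries_shift; last 2 first.
- by move=> k; rewrite mule_ge0 ?lee_fin// ltW// divr_gt0 ?exprn_gt0 ?qfact_gt0.
- by move=> k; exact: term_ge0.
apply: lee_nneseries => [k _ _|k _]; first exact: term_ge0.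
rewrite -EFinM lee_fin mulrA ler_pM2r ?invr_gt0 ?qfact_gt0//.
by rewrite expr1n mulr1 exprS ler_piMr// exprn_ile1.
Qed.

Let phi (n : nat) : K := \prod_(i < n) (1 - t ^+ i.+1).

Let phiS n : phi n.+1 = phi n * (1 - t ^+ n.+1).
Proof. by rewrite /phi big_ord_recr. Qed.

Let PS n : P n.+1 = P n * (1 + t ^+ n.+1).
Proof. by rewrite /P big_ord_recr. Qed.

Let tX_lt1 n : t ^+ n.+1 < 1.
Proof. by rewrite exprn_ilt1// ?(ltW t_gt0)//; have := t_le; have := t_gt0; lra. Qed.

Let phi_gt0 n : 0 < phi n.
Proof. by apply: prodr_gt0 => i _; rewrite subr_gt0. Qed.

Let mu_partialS n :
  mu_partial K p n.+1 = mu_partial K p n * (1 - t ^+ (2 * n).+1).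
Proof.
rewrite /mu_partial big_nat_recr//=; congr (_ * (1 - _)).
have -> : 1 - (2 * n.+1)%:Z = - (2 * n).+1%:Z :> int.
  by rewrite mulnS -opprB; congr (- _); rewrite subzn.
by rewrite -exprz_inv -exprnP.
Qed.

(** The product [(1 - t^i) (1 + t^i) = 1 - t^(2i)] supplies the even exponents, and [mu_partial] the
    odd ones. *)
Let euler_telescope n : phi n * mu_partial K p n * P n = phi (2 * n).
Proof.
elim: n => [|n IHn]; first by rewrite /phi /P /mu_partial !big_ord0 big_geq// !mulr1.
rewrite mulnS !addSn add0n !phiS -IHn mu_partialS PS.
have -> : 1 - t ^+ (2 * n).+2 = (1 - t ^+ n.+1) * (1 + t ^+ n.+1).
  have -> : (2 * n).+2 = (n.+1 + n.+1)%N by lia.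
  by rewrite exprD; lra.
lra.
Qed.

(** The summand [t ^+ (n + k)] is what makes the induction close, as [2 * t <= 1]; the use made of
    it is that [phi (2 n) / phi n] tends to 1. *)
Let phi_ratio n k : phi n * (1 - t ^+ n + t ^+ (n + k)) <= phi (n + k) <= phi n.
Proof.
elim: k => [|k /andP[IH1 IH2]]; first by rewrite addn0 subrK mulr1 lexx.
rewrite addnS phiS.
have ht := tX_lt1 (n + k); have h0 : 0 < t ^+ (n + k) by rewrite exprn_gt0.
have hS : t ^+ (n + k).+1 = t * t ^+ (n + k) by rewrite exprS.
have h1 : 2 * t ^+ (n + k).+1 <= t ^+ (n + k).
  by rewrite hS mulrA ler_piMl// ltW.
have h3 : 0 < t ^+ (n + k).+1 by rewrite exprn_gt0.
have tn : t ^+ (n + k) <= t ^+ n.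
  rewrite exprD ler_piMr ?exprn_ge0 ?(ltW t_gt0)// exprn_ile1 ?(ltW t_gt0)//.
  by have := t_le; have := t_gt0; lra.
have pn := phi_gt0 n; have pnk := phi_gt0 (n + k).
apply/andP; split; last by nra.
apply: (@le_trans _ _ (phi n * (1 - t ^+ n + t ^+ (n + k)) * (1 - t ^+ (n + k).+1))).
  rewrite -mulrA ler_pM2l//; nra.
by rewrite ler_pM2r// subr_gt0.
Qed.

(** Here [e1 = P n * qseries (t ^ n)], while [mu_partial n * P n = phi (2 n) / phi n] lies between
    [1 - t ^ n] and 1. *)
Let mu_partial_bound n :
  1 - t ^+ n <= mu_partial K p n * e1 <= 1 + t ^+ n * e1.
Proof.
have t0 := ltW t_gt0.
have tn1 : t ^+ n <= 1 by rewrite exprn_ile1//; have := t_le; lra.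
have tn0 : 0 <= t ^+ n by rewrite exprn_ge0.
have /andP[h1 h2] := qseries_bound tn0 tn1.
have hf : qseries (t ^+ n) \is a fin_num.
  rewrite ge0_fin_numE; first by rewrite (le_lt_trans h2)// ltry.
  exact: le_trans h1.
have := qseries_P n; rewrite -(fineK hf) qseries1E -EFinM => -[e1E].
move: h1 h2; rewrite -(fineK hf) !lee_fin; set x := fine _ in e1E * => h1 h2.
have /andP[r1 r2] := phi_ratio n n.
have := euler_telescope n; rewrite mul2n -addnn -mulrA => tel.
rewrite -tel ler_pM2l// in r1.
have {}r2 : mu_partial K p n * P n <= 1 by rewrite -(ler_pM2l (phi_gt0 n)) mulr1 tel.
have tnn : 0 <= t ^+ (n + n) by rewrite exprn_ge0.
have mu0 := mu_partial_ge0 K p n.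
have P0 : 0 <= P n by apply: prodr_ge0 => i _; rewrite addr_ge0// exprn_ge0.
have e10 : 0 <= e1 by rewrite e1E mulr_ge0//; lra.
rewrite {1}e1E {1}e1E mulrA; set z := mu_partial K p n * P n in r1 r2 *.
have z0 : 0 <= z by rewrite mulr_ge0.
apply/andP; split.
  apply: (@le_trans _ _ z); first lra.
  by rewrite ler_peMr.
apply: (@le_trans _ _ x); last exact: h2.
by rewrite ler_piMl//; lra.
Qed.

Local Open Scope classical_set_scope.

Lemma mu_product_qseries : ((mu_product K p)%:E * qseries 1 = 1)%E.
Proof.
rewrite qseries1E -EFinM; congr _%:E.
have cmu : mu_partial K p n @[n --> \oo] --> mu_product K p.
  exact: is_cvg_mu_partial.
have c1 : (mu_partial K p n * e1) @[n --> \oo] --> mu_product K p * e1.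
  by apply: cvgMr_tmp.
have c2 : (mu_partial K p n * e1) @[n --> \oo] --> (1 : K).
  have ct : t ^+ n @[n --> \oo] --> (0 : K).
    by apply: cvg_expr; rewrite ger0_norm ?(ltW t_gt0)//; have := t_le; have := t_gt0; lra.
  apply: (@squeeze_cvgr _ _ _ _ (fun n => 1 - t ^+ n) (fun n => 1 + t ^+ n * e1)).
  - by apply: nearW => n; exact: mu_partial_bound.
  - rewrite -[X in _ --> X]subr0; apply: cvgB => //; exact: cvg_cst.
  - rewrite -[X in _ --> X]addr0 -[X in _ --> _ + X](mul0r e1).
    apply: cvgD; first exact: cvg_cst.
    exact: cvgMr_tmp.
exact: cvg_unique c1 c2.
Qed.

End Euler.

(** * The distribution of the rank *)

Section RankDistribution.
Variables (K : realType) (p : nat).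
Hypothesis p_prime : prime p.

Let P (e : nat) : K := p%:R ^+ e.
Let D := qfact K p.
Let pi := mu_product K p.
Let X := @rank_class p.

Let P_neq0 e : P e != 0.
Proof. by rewrite expf_neq0// pnatr_eq0 -lt0n prime_gt0. Qed.

Let PD e e' : P (e + e') = P e * P e'.
Proof. by rewrite /P exprD. Qed.

Let D_gt0 r : 0 < D r.
Proof. exact: qfact_gt0. Qed.

Let D_neq0 r : D r != 0.
Proof. by rewrite gt_eqF. Qed.

Let DS r : D r.+1 = D r * (P r.+1 - 1).
Proof. exact: qfactS. Qed.

Let D0 : D 0 = 1.
Proof. exact: qfact0. Qed.

Let pi_gt0 : 0 < pi.
Proof.
rewrite lt_neqAle mu_product_ge0 andbT eq_sym; apply/eqP => pi0.
have := mu_product_qseries K p_prime; rewrite -/pi pi0 mul0e => /eqP.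
by rewrite eq_sym onee_eq0.
Qed.

Let pi_neq0 : pi != 0.
Proof. by rewrite gt_eqF. Qed.

Let sigma_qfact n s : (s <= n)%N -> (sigma p n s)%:R * D (n - s) = P 'C(s, 2) * D n.
Proof.
elim: s => [|s IHs] sn; first by rewrite subn0 /sigma big_ord0 /P expr0.
rewrite /sigma big_ord_recr /= -/(sigma p n s) natrM natrB; last first.
  by rewrite leq_exp2l ?prime_gt1// ltnW.
rewrite !natrX -/(P n) -/(P s) binS bin1 PD.
have := IHs (ltnW sn).
have -> : (n - s)%N = (n - s.+1).+1 by lia.
rewrite DS => h.
have -> : P n = P s * P (n - s.+1).+1 by rewrite -PD; congr P; lia.
rewrite [RHS]mulrAC -h /P; set a := (sigma _ _ _)%:R; set b := D _; set c := p%:R ^+ s.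
by set d := p%:R ^+ _; lra.
Qed.

(** Dividing by [pi] leaves the total of [1 / (#A * #Aut)]; [mu_X] shows that [fine] loses
    nothing. *)
Let W (s m : nat) : K := fine (mu K (X s m)) / pi.

Let mu_X s m : mu K (X s m) = (pi * W s m)%:E.
Proof.
rewrite /W mulrC divfK// fineK//.
have := mu_rank_class p_prime K (leqnSn m) (leqnn s); set c := (_ / _ in X in (_ * X)%E).
have c_gt0 : 0 < c.
  by rewrite divr_gt0 ?exprn_gt0 ?ltr0n ?sigma_gt0// prime_gt0.
have mu0 : (0 <= mu K (X s m))%E by exact: measure_ge0.
rewrite -/X; move: mu0; case: (mu K (X s m)) => // _.
by rewrite gt0_mulye ?lte_fin.
Qed.

Let weightE M n m s : (m <= M.+1)%N -> (s <= n)%N ->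
  weight p M K n m s = (sigma p n s)%:R / P (n * s) * W s m.
Proof.
move=> mM sn; apply: (mulfI pi_neq0).
have := mu_rank_class p_prime K mM sn; rewrite -/X mu_X -EFinM => -[].
by rewrite -/pi => <-; rewrite mulrAC -mulrA.
Qed.

(** By [full_countE], the number of nondegenerate symmetric forms on [F_p^t] divided by [D t],
    whatever the modulus. *)
Let v t := P 'C(t.+1, 2) * W t 1.

Let full_countE M t : (full_count p M t)%:R = D t * v t.
Proof.
have := weight_full_count M p_prime K t; rewrite (weightE (ltn0Sn M) (leqnn t)).
move=> /(congr1 (fun x => x * P (t * t.+1))); rewrite divfK// => <-.
have := sigma_qfact (leqnn t); rewrite subnn D0 mulr1 => ->.
rewrite mulnS PD /v binS bin1 PD.
have -> : P 'C(t, 2) * D t / P (t * t) * W t 1 * (P t * P (t * t)) =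
    P 'C(t, 2) * D t * W t 1 * P t * (P (t * t) / P (t * t)) by lra.
by rewrite divff//; lra.
Qed.

(** The field computation behind one term of [W_rec]; the powers of [p] enter only through
    [a * d = b * e]. *)
Let term_cancel (Dt w a b c sg e x d Dn : K) : b != 0 -> e != 0 ->
  a * d = b * e -> sg * Dt = d * Dn ->
  Dt * w * a / b / c * (sg / e * x) = Dn / c * (w * x).
Proof.
move=> b0 e0 ad sD; set b' := b^-1; set c' := c^-1; set e' := e^-1.
have bb : b * b' = 1 by rewrite mulfV.
have ee : e * e' = 1 by rewrite mulfV.
have -> : Dt * w * a * b' * c' * (sg * e' * x) = (sg * Dt) * a * (b' * e' * w * c' * x).
  by lra.
have -> : sg * Dt * a = (b * e) * Dn by rewrite sD -ad; lra.
have -> : b * e * Dn * (b' * e' * w * c' * x) = (b * b') * (e * e') * (Dn * c' * (w * x)).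
  by lra.
by rewrite bb ee !mul1r.
Qed.

Let triangle n : ('C(n.+1, 2) * 2 = n.+1 * n)%N.
Proof. by elim: n => [|n IHn] //; rewrite binS bin1 mulnDl IHn; lia. Qed.

Let triangleD s u : ('C((s + u).+1, 2) + 'C(s, 2) = 'C(u.+1, 2) + (s + u) * s)%N.
Proof.
have := triangle (s + u); have := triangle u; have := triangle s.
by rewrite (binS s) bin1; lia.
Qed.

(** This is [weight_rec] for [r x r] matrices modulo [p ^ m.+1], with weights expressed through [W]
    and divided by the common factor [D r / p ^ (r * r.+1)]. *)
Let W_rec r m : P 'C(r.+1, 2) * W r m.+1 = \sum_(s < r.+1) v (r - s) * W s m.
Proof.
have := weight_rec p_prime K r (leqnn m).
rewrite (weightE (leqnn m.+1) (leqnn r)).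
rewrite (eq_bigr (fun s : 'I_r.+1 => D r / P (r * r.+1) * (v (r - s) * W s m))); last first.
  move=> s _; have sr : (s <= r)%N by rewrite -ltnS ltn_ord.
  rewrite (weightE (leqnSn m) sr) full_countE.
  apply: term_cancel (P_neq0 _) (P_neq0 _) _ (sigma_qfact sr).
  rewrite -!/(P _) -!PD; congr P.
  by have := triangleD s (r - s); rewrite subnKC.
have := sigma_qfact (leqnn r); rewrite subnn D0 mulr1 => ->.
rewrite -mulr_sumr; set S := \sum_(_ < _) _ => h.
have c0 : D r / P (r * r.+1) != 0 by rewrite mulf_neq0// invr_neq0.
apply: (mulfI c0); rewrite -h binS bin1 mulnS !PD invfM.
have -> : D r * ((P r)^-1 * (P (r * r))^-1) * (P 'C(r, 2) * P r * W r m.+1) =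
  (P r / P r) * (P 'C(r, 2) * D r / P (r * r) * W r m.+1) by lra.
by rewrite divff// mul1r.
Qed.

(** This is [weight_total] with [M = 0], reindexed so that [s] is the corank. *)
Let qfact_rec r : P 'C(r.+1, 2) / D r = \sum_(s < r.+1) v (r - s) / D s.
Proof.
rewrite -[P _](weight_total 0 p_prime K r) mulr_suml (reindex_inj rev_ord_inj) /=.
apply: eq_bigr => s _; have sr : (s <= r)%N by rewrite -ltnS ltn_ord.
rewrite subSS (weightE _ (leq_subr s r))// -/(P _).
have := sigma_qfact (leq_subr s r); rewrite subKn// => h.
have {h} -> : (sigma p r (r - s))%:R = P 'C(r - s, 2) * D r / D s.
  by apply: (mulIf (D_neq0 s)); rewrite divfK.
rewrite mulnS PD mulnC /v binS bin1 PD.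
have -> : P (r - s) * P (r * (r - s)) *
    (P 'C(r - s, 2) * D r / D s / P (r * (r - s)) * W (r - s) 1) / D r =
  (P (r * (r - s)) / P (r * (r - s))) * (D r / D r) *
    (P 'C(r - s, 2) * P (r - s) * W (r - s) 1 / D s) by lra.
by rewrite !divff// !mul1r.
Qed.

Let W_ge0 s m : 0 <= W s m.
Proof. by rewrite divr_ge0 ?(ltW pi_gt0)// fine_ge0. Qed.

Let v_ge0 t : 0 <= v t.
Proof. by rewrite mulr_ge0// exprn_ge0. Qed.

Let v0 : v 0 = 1.
Proof.
have := qfact_rec 0; rewrite big_ord1 subnn D0 !divr1 => <-.
by rewrite /P expr0.
Qed.

Let X_mono s m : (X s m `<=` X s m.+1)%classic.
Proof. by move=> c [rc kc]; split=> // x; rewrite expnSr mulrnA kc mul0rn. Qed.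

Let W_mono s m : W s m <= W s m.+1.
Proof.
rewrite -(ler_pM2l pi_gt0) -lee_fin -!mu_X.
by apply: (le_measure (@mu K p)); rewrite ?inE//; exact: X_mono.
Qed.

Let P_gt0 e : 0 < P e.
Proof. by rewrite exprn_gt0// ltr0n prime_gt0. Qed.

(** [W] and [1 / D] satisfy the same recurrence with nonnegative coefficients. The induction starts
    at [m = 1], where [v s] is one term of the sum in [qfact_rec]. *)
Let W_le s m : W s m <= (D s)^-1.
Proof.
apply: (le_trans (W_mono s m)); elim: m s => [|m IHm] s.
  rewrite -(ler_pM2l (P_gt0 'C(s.+1, 2))) -/(v s) qfact_rec big_ord_recl subn0.
  rewrite D0 divr1 lerDl; apply: sumr_ge0 => i _.
  by rewrite divr_ge0// ltW.
rewrite -(ler_pM2l (P_gt0 'C(s.+1, 2))) W_rec qfact_rec; apply: ler_sum => i _.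
by rewrite ler_wpM2l.
Qed.

Local Open Scope classical_set_scope.

(** Monotone bounded sequences converge, and their limits satisfy the recurrence of [1 / D]. Since
    [v 0 = 1], the value at [r > 0] has coefficient [P 'C(r.+1, 2) - 1], which is nonzero, so the
    earlier values determine it. *)
Let W_cvg r : W r m @[m --> \oo] --> (D r)^-1.
Proof.
have cvgW s : cvgn (W s).
  apply: nondecreasing_is_cvgn; first exact/nondecreasing_seqP/W_mono.
  by exists (D s)^-1 => _ [m _ <-]; exact: W_le.
pose l s := limn (W s).
have lrec s : P 'C(s.+1, 2) * l s = \sum_(i < s.+1) v (s - i) * l i.
  have c1 : (P 'C(s.+1, 2) * W s m.+1) @[m --> \oo] --> P 'C(s.+1, 2) * l s.
    by apply: cvgMl_tmp; rewrite (cvg_shiftS (W s)); exact: cvgW.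
  have c2 : (\sum_(i < s.+1) v (s - i) * W i m) @[m --> \oo] -->
      \sum_(i < s.+1) v (s - i) * l i.
    apply: (@cvg_big _ _ +%R); first exact: add_continuous.
    by move=> i _; apply: cvgMl_tmp; exact: cvgW.
  apply: (cvg_unique _ c1); rewrite // (_ : (fun m => _) =
    (fun m => \sum_(i < s.+1) v (s - i) * W i m))//.
  by apply/funext => m; exact: W_rec.
suff <- : l r = (D r)^-1 by exact: cvgW.
elim/ltn_ind: r => r IHr.
have h1 := lrec r; rewrite big_ord_recr /= subnn v0 mul1r in h1.
rewrite (eq_bigr (fun i : 'I_r => v (r - i) / D i)) in h1; last first.
  by move=> i _; rewrite IHr.
have h2 := qfact_rec r; rewrite big_ord_recr /= subnn v0 mul1r in h2.
(* At [r = 0] the recurrence says nothing about the limit, but [W 0 m] is constantly [v 0 = 1]. *)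
case: r IHr h1 h2 => [|r] IHr h1 h2.
  have W00 m : W 0 m.+1 = W 0 m.
    have := W_rec 0 m; rewrite big_ord1 subnn v0 mul1r => <-.
    by rewrite /P expr0 mul1r.
  have W0 m : W 0 m = 1.
    elim: m => [|m <-//]; rewrite -W00 -v0 /v /P expr0 mul1r//.
  rewrite /l D0 invr1 (_ : W 0 = fun=> 1) ?lim_cst//.
  exact/funext.
have P1 : P 'C(r.+2, 2) - 1 != 0.
  have : (0 < 'C(r.+2, 2))%N by rewrite bin_gt0.
  case: 'C(r.+2, 2) => // e _; have := pexp_ge2 K p_prime e; rewrite -/(P _).
  by move=> h; rewrite gt_eqF//; lra.
by apply: (mulfI P1); rewrite !mulrBl h1 h2; lra.
Qed.

Lemma mu_prank r :
  mu K [set c : isoClass p | class_prank c = r] = (mu_product K p / qfact K p r)%:E.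
Proof.
have -> : [set c : isoClass p | class_prank c = r] = \bigcup_m X r m.
  apply/seteqP; split=> [c rc|c [m _ []]//].
  (* A group of order [p ^ m] is killed by [p ^ m], so the rank classes of bounded exponent exhaust
     rank [r]. *)
  have /p_natP[m cm] := dp_pgroup (generic_quotient.repr c).
  exists m => //; split=> // x; rewrite -cm.
  by have := expg_cardG (finset.in_setT x); rewrite FinRing.zmodXgE.
have c1 : mu K (X r m) @[m --> \oo] --> mu K (\bigcup_m X r m).
  apply: (@nondecreasing_cvg_mu _ _ _ (@mu K p) (X r)) => //.
  by apply/nondecreasing_seqP => m; apply/subsetPset; exact: X_mono.
apply: (cvg_unique _ c1) => //.
rewrite (_ : (fun m => _) = (fun m => (pi * W r m)%:E)); last first.
  by apply/funext => m; exact: mu_X.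
apply: cvg_EFin; first by apply: nearW.
by apply: cvgMl_tmp; exact: W_cvg.
Qed.

End RankDistribution.

(** * Moments of the rank *)

Theorem theorem3p6 (R : realType) (p : nat) (p_prime : prime p) (k : nat) :
  (\int[@mu R p]_(x in [set: isoClass p]) (p%:R ^+ (k * class_prank x))%:E =
   (\prod_(0 <= j < k) (p%:R ^+ j + 1))%:E)%E.
Proof.
pose F r : set (isoClass p) := [set c : isoClass p | class_prank c = r]%classic.
have -> : [set: isoClass p]%classic = (\bigcup_r F r)%classic.
  by apply/seteqP; split=> // c _; exists (class_prank c).
rewrite ge0_integral_bigcup//; last first.
  by move=> i j _ _ [c [<- <-]].
(* Euler's identity inserts [mu_product * qseries 1 = 1], and the functional equation absorbs the
   product, so the right side becomes [mu_product * qseries (p ^ k)]. This is compared with the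
   integral rank by rank. *)
rewrite -[RHS]mule1 -(mu_product_qseries R p_prime) muleCA -qseries_mulpX//.
rewrite /qseries -nneseriesZl; last first.
  move=> r _; rewrite lee_fin divr_ge0 ?exprn_ge0// ltW// qfact_gt0//.
apply: eq_eseriesr => r _.
transitivity (\int[@mu R p]_(x in F r) cst ((p%:R ^+ k) ^+ r)%:E x)%E.
  by apply: eq_integral => c; rewrite inE /= => <-; rewrite exprM.
rewrite integral_cst//=; rewrite [X in (_ * X)%E](mu_prank R p_prime r).
by rewrite -!EFinM mulrCA.
Qed.
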